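(* Let $0<q<1$ and let $a,b,c$ be real numbers such that $ab,ac,bc\notin\{-q^{-k}: k=1,2,\dots\}$ and $ab,ac,bc\notin[-1,0]$. Let $w(x)$ be a $q^{-1}$-Hermite weight normalized by $\int_{-\infty}^{\infty}w(x)\,dx=1$, and put $$w(x;a,b,c)=\left(-\frac{q}{a}e^{u},\frac{q}{a}e^{-u},-\frac{q}{b}e^{u},\frac{q}{b}e^{-u},-\frac{q}{c}e^{u},\frac{q}{c}e^{-u};q\right)_{\infty}w(x),\qquad x=\sinh(u).$$ Then the sequence of continuous dual $q^{-1}$-Hahn polynomials $\{q_n(x;a,b,c|q)\}_{n\ge0}$ satisfies the orthogonality relation $$\int_{-\infty}^{\infty}q_n(x;a,b,c|q)\,q_m(x;a,b,c|q)\,w(x;a,b,c)\,dx=k_n\,\delta_{m,n},\qquad m,n=0,1,2,\dots,$$ where $$k_n=4^{-n}q^{-\frac{n(n+1)}{2}}\left(-\frac{q}{abq^n},-\frac{q}{acq^n},-\frac{q}{bcq^n};q\right)_{\infty}\left(q^n;\frac1q\right)_n>0.$$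
   Context: The $q$-shifted factorials with base $p$ are $(\alpha;p)_0=1$, $(\alpha;p)_k=\prod_{j=0}^{k-1}(1-\alpha p^j)$ for $k=1,2,\dots$ (or $k=\infty$ when $0<p<1$), and $(\alpha_1,\dots,\alpha_i;p)_k=\prod_{j=1}^i(\alpha_j;p)_k$. For nonzero parameters $a,b,c$, the continuous dual $q^{-1}$-Hahn polynomials are the monic polynomials of degree $n$ in $x=\sinh(u)$ $$q_n(x;a,b,c|q)=\left(-\frac a2\right)^n\left(-\frac1{ab},-\frac1{ac};\frac1q\right)_n\sum_{k=0}^n\frac{\left(q^n,-\frac{e^u}{a},\frac{e^{-u}}{a};\frac1q\right)_k}{\left(-\frac1{ab},-\frac1{ac};\frac1q\right)_k}\,\frac{q^{-k}}{\left(\frac1q;\frac1q\right)_k},\qquad n=0,1,2,\dots,$$ where the quotient $(\alpha;\frac1q)_n/(\alpha;\frac1q)_k$ is read as $\prod_{j=k}^{n-1}(1-\alpha q^{-j})$. The (monic) $q^{-1}$-Hermite polynomials $h_n$ are defined by $h_{-1}=0$, $h_0=1$, $h_{n+1}(x)=x\,h_n(x)-\frac14(q^{-n}-1)h_{n-1}(x)$. A $q^{-1}$-Hermite weight is a weight function $w\ge 0$ on $\mathbb{R}$, with finite moments of all orders, with respect to which the $q^{-1}$-Hermite polynomials are orthogonal: $\int_{-\infty}^\infty h_n h_m\,w\,dx=0$ for $m\ne n$ and $\neq 0$ for $m=n$. The weight $w(x;a,b,c)$ is not required to be nonnegative.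
   Formalization: ''k_n>0'' fails for some allowed a,b,c (q=1/2, a=3/2, b=3, c=-1 gives k_2<0); proved instead: k_n≠0 for all n, k_n>0 if ab,ac,bc lie outside [-q^{1-n},0], and k_n>0 exactly when (-1/ab,-1/ac,-1/bc;1/q)_n>0. *)

(* Defs.v *)
From HB Require Import structures.
From mathcomp Require Import all_boot all_order all_algebra.
From mathcomp Require Import all_classical all_reals all_analysis.
From mathcomp Require Import ring lra.

Set Implicit Arguments.
Unset Strict Implicit.
Unset Printing Implicit Defensive.

Import Order.TTheory GRing.Theory Num.Theory.
Import numFieldNormedType.Exports.

Local Open Scope ring_scope.

Section Defs.
Variable R : realType.
Implicit Types (q p al a b c x u : R) (s : seq R) (n k : nat).

Definition sinh u : R := (expR u - expR (- u)) / 2.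

Definition arsinh x : R := ln (x + Num.sqrt (x ^+ 2 + 1)).

Lemma expR_arsinh x : expR (arsinh x) = x + Num.sqrt (x ^+ 2 + 1).
Proof.
rewrite /arsinh lnK // posrE.
have h : `|x| < Num.sqrt (x ^+ 2 + 1).
  by rewrite -sqrtr_sqr ltr_sqrt ?ltrDl // ltr_wpDl ?sqr_ge0.
by rewrite -ltrBlDl sub0r; apply: le_lt_trans h; rewrite -normrN ler_norm.
Qed.

Lemma arsinhK x : sinh (arsinh x) = x.
Proof.
have y0 : x + Num.sqrt (x ^+ 2 + 1) != 0.
  by rewrite -expR_arsinh gt_eqF // expR_gt0.
have hs : Num.sqrt (x ^+ 2 + 1) ^+ 2 = x ^+ 2 + 1.
  by rewrite sqr_sqrtr // addr_ge0 ?sqr_ge0.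
rewrite /sinh expRN expR_arsinh.
have -> : (x + Num.sqrt (x ^+ 2 + 1))^-1 = Num.sqrt (x ^+ 2 + 1) - x.
  apply: (mulfI y0); rewrite mulfV //.
  have -> : (x + Num.sqrt (x ^+ 2 + 1)) * (Num.sqrt (x ^+ 2 + 1) - x)
    = Num.sqrt (x ^+ 2 + 1) ^+ 2 - x ^+ 2 by ring.
  by rewrite hs; ring.
by field.
Qed.

Definition qpoch al p n : R := \prod_(0 <= j < n) (1 - al * p ^+ j).

Definition qpoch_inf al p : R := limn (qpoch al p).

Definition qpochs s p n : R := \prod_(al <- s) qpoch al p n.

Definition qpochs_inf s p : R := \prod_(al <- s) qpoch_inf al p.

(* The quotient (al; p)_n / (al; p)_k for k <= n, with the common factors
   cancelled, so that it is meaningful even when (al; p)_k = 0. *)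
Definition qpoch_quot al p n k : R := \prod_(k <= j < n) (1 - al * p ^+ j).

(* A polynomial in x = sinh u, evaluated at the point x through u = arsinh x. *)
Definition cdqHahn q a b c n x : R :=
  let u := arsinh x in
  (- (a / 2)) ^+ n *
  \sum_(0 <= k < n.+1)
    qpochs [:: q ^+ n; - (expR u / a); expR (- u) / a] q^-1 k
    * qpoch_quot (- (a * b)^-1) q^-1 n k
    * qpoch_quot (- (a * c)^-1) q^-1 n k
    * (q ^- k / qpoch q^-1 q^-1 k).

(* The pair (h_(n-1) x, h_n x), started from h_(-1) = 0 and h_0 = 1. *)
Fixpoint qinvHermite_pair q n x : R * R :=
  if n is m.+1 then
    let: (h', h) := qinvHermite_pair q m x in
    (h, x * h - 4^-1 * (q ^- m - 1) * h')
  else (0, 1).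

Definition qinvHermite q n x : R := (qinvHermite_pair q n x).2.

Record qinvHermite_weight q (w : R -> R) : Prop := {
  weight_measurable : measurable_fun [set: R] w ;
  weight_ge0 : forall x, 0 <= w x ;
  weight_moments : forall n,
    lebesgue_measure.-integrable [set: R] (fun x => (x ^+ n * w x)%:E) ;
  weight_orthogonal : forall m n, m != n ->
    \int[lebesgue_measure]_x (qinvHermite q n x * qinvHermite q m x * w x) = 0 ;
  weight_norm : forall n,
    \int[lebesgue_measure]_x (qinvHermite q n x * qinvHermite q n x * w x) != 0
}.

Definition cdqHahn_weight q a b c (w : R -> R) x : R :=
  let u := arsinh x in
  qpochs_inf [:: - (q / a * expR u); q / a * expR (- u);
                 - (q / b * expR u); q / b * expR (- u);
                 - (q / c * expR u); q / c * expR (- u)] q * w x.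

Definition cdqHahn_norm q a b c n : R :=
  4 ^- n * q ^- (n * n.+1)./2
  * qpochs_inf [:: - (q / (a * b * q ^+ n)); - (q / (a * c * q ^+ n));
                   - (q / (b * c * q ^+ n))] q
  * qpoch (q ^+ n) q^-1 n.

End Defs.

(* Main.v *)
(** Write x = sinh u and G_t(x) = (-t e^u, t e^(-u); q)_oo. Then w(x; a, b, c) is
    G_(q/a) G_(q/b) G_(q/c) w, and G_t is a generating function of the
    q^-1-Hermite polynomials. The moment problem for w is indeterminate, so
    integrals against w are only accessible through the moments. These are of
    order q^(-k^2/8), whereas a product of three functions G_t is dominated by a
    power series in 1 + |x| with coefficients of order q^(k^2/6); hence such
    products may be integrated term by term.

    The relation G_(t/q) = (1 + 2 x t/q - t^2/q^2) G_t turns the three-term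
    recurrence of h_k into a recurrence for the integrals of h_k G_s G_t w, which
    starts from the case k = 0. Applied successively with none, one and two of
    s, t nonzero, and summed over k against the generating function, it gives
    int G_r G_s G_t w = (-rs/q, -rt/q, -st/q; q)_oo.

    Finally (-e^u/a, e^(-u)/a; 1/q)_k G_(q/a) = G_(q^(1-k)/a), so the integral of
    q_n against (-e^u/b, e^(-u)/b; 1/q)_j is a q-Chu-Vandermonde sum, which
    vanishes for j < n; the case j = n gives the norm. *)

Require Import Defs.
From HB Require Import structures.
From mathcomp Require Import all_boot all_order all_algebra.
From mathcomp Require Import all_classical all_reals all_analysis.
From mathcomp Require Import measurable_realfun ring lra zify.
Import Order.TTheory GRing.Theory Num.Theory.
Import numFieldNormedType.Exports.
Local Open Scope ring_scope.

Set Implicit Arguments.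
Unset Strict Implicit.
Unset Printing Implicit Defensive.

(** * The q-exponential coefficients and their convolutions *)

Section QExp.
Variables (R : realType) (q : R).
Hypothesis hq : 0 < q < 1.
Implicit Types (t x y z : R) (n k N : nat).

Let q0 : 0 < q. Proof. by case/andP: hq. Qed.
Let q1 : q < 1. Proof. by case/andP: hq. Qed.
Let qN0 : q != 0. Proof. by rewrite gt_eqF. Qed.

Lemma qpoch0 al p : qpoch al p 0 = 1 :> R.
Proof. by rewrite /qpoch big_geq. Qed.

Lemma qpoch0l p n : qpoch 0 p n = 1 :> R.
Proof. by rewrite /qpoch big1 // => i _; rewrite mul0r subr0. Qed.

Lemma qpochS al p n : qpoch al p n.+1 = qpoch al p n * (1 - al * p ^+ n) :> R.
Proof. by rewrite /qpoch big_nat_recr. Qed.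

Lemma qpochSl al p n : qpoch al p n.+1 = (1 - al) * qpoch (al * p) p n :> R.
Proof.
rewrite /qpoch big_nat_recl // expr0 mulr1; congr (_ * _).
by apply: eq_bigr => i _; rewrite exprS mulrA.
Qed.

Lemma onemqX_gt0 n : 0 < 1 - q ^+ n.+1.
Proof. by rewrite subr_gt0 exprn_ilt1 // ltW. Qed.

Lemma qpochqq_gt0 n : 0 < qpoch q q n.
Proof.
by elim: n => [|n IH]; rewrite ?qpoch0 // qpochS mulr_gt0 // -exprS onemqX_gt0.
Qed.

(** Euler's coefficients: (-z; q)_oo is the sum of e_k z^k ([qexp_cvg]). *)
Definition qexp_coef k : R := q ^+ 'C(k, 2) / qpoch q q k.
Local Notation e := qexp_coef.

Lemma qexp_coef_gt0 k : 0 < e k.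
Proof. by rewrite divr_gt0 ?exprn_gt0 ?qpochqq_gt0. Qed.

Lemma qexp_coef0 : e 0 = 1.
Proof. by rewrite /e qpoch0 bin0n expr0 divr1. Qed.

Lemma qexp_coefS k : e k.+1 * (1 - q ^+ k.+1) = e k * q ^+ k.
Proof.
rewrite /e binS bin1 exprD qpochS -exprS.
by field; rewrite !gt_eqF ?onemqX_gt0 ?qpochqq_gt0.
Qed.

(* Since e_k [k, i]_(1/q) = e_i e_(k-i), this is e_k times the homogeneous
   Rogers-Szego polynomial in base 1/q. *)
Definition qconv k x y : R := \sum_(i < k.+1) e i * e (k - i) * x ^+ i * y ^+ (k - i).
Local Notation s := qconv.

Lemma qconv0 x y : s 0 x y = 1.
Proof. by rewrite /s big_ord1 qexp_coef0 !expr0 !mulr1. Qed.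

Lemma qconvC k x y : s k x y = s k y x.
Proof.
rewrite /s (reindex_inj rev_ord_inj) /=; apply: eq_bigr => i _.
by rewrite subSS subKn -1?ltnS // mulrAC [e i * _]mulrC.
Qed.

Lemma qconv_homog k z x y : s k (z * x) (z * y) = z ^+ k * s k x y.
Proof.
rewrite /s mulr_sumr; apply: eq_bigr => i _.
have -> : z ^+ k = z ^+ i * z ^+ (k - i) by rewrite -exprD subnKC // -ltnS.
by rewrite !exprMn; ring.
Qed.

Lemma qconv_r0 k x : s k x 0 = e k * x ^+ k.
Proof.
rewrite /s (bigD1 ord_max) //= subnn qexp_coef0 big1 ?addr0; first by ring.
move=> i; rewrite -val_eqE /= => ik.
have : (0 < k - i)%N by rewrite subn_gt0 ltn_neqAle ik -ltnS ltn_ord.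
by case: (k - i)%N => // m _; rewrite expr0n mulr0.
Qed.

Lemma qconv_ge0 k x y : 0 <= x -> 0 <= y -> 0 <= s k x y.
Proof.
move=> x0 y0; apply: sumr_ge0 => i _.
by do 3?apply: mulr_ge0; rewrite ?exprn_ge0 // ltW // qexp_coef_gt0.
Qed.

Lemma normr_qconv k x y : `|s k x y| <= s k `|x| `|y|.
Proof.
apply: le_trans (ler_norm_sum _ _ _) _; apply: ler_sum => i _.
by rewrite 3!normrM !normrX !(gtr0_norm (qexp_coef_gt0 _)).
Qed.

Lemma qexp_coefSV k : e k.+1 * (q^-1 ^+ k.+1 - 1) = q^-1 * e k.
Proof.
have qk : q ^+ k != 0 by rewrite expf_neq0.
rewrite exprVn; apply: (mulIf qk).
rewrite -[RHS]mulrA -qexp_coefS exprS; field.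
by rewrite qk qN0.
Qed.

(** Coefficient form of E(x/q) E(y) = (1 + x/q) E(x) E(y), where E(z) = (-z; q)_oo: dividing x by q
    multiplies the i-th term by q^-i, and [qexp_coefSV] turns e_i (q^-i - 1) into e_(i-1)/q. *)
Lemma qconv_shiftl k x y :
  s k.+1 (q^-1 * x) y - s k.+1 x y = q^-1 * x * s k x y.
Proof.
rewrite /s -sumrB big_ord_recl /= expr0 !mulr1 subrr add0r mulr_sumr.
apply: eq_bigr => i _; rewrite /bump /= add1n subSS exprMn.
transitivity (e i.+1 * (q^-1 ^+ i.+1 - 1) * e (k - i) * x ^+ i.+1 * y ^+ (k - i)).
  by ring.
by rewrite qexp_coefSV exprS; ring.
Qed.

Definition qconv_prev k x y : R := if k is k'.+1 then s k' x y else 0.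

Lemma qconv_shiftl_prev k x y :
  s k (q^-1 * x) y = s k x y + q^-1 * x * qconv_prev k x y.
Proof.
case: k => [|k]; first by rewrite !qconv0 mulr0 addr0.
by rewrite -qconv_shiftl addrC subrK.
Qed.

(** Dividing both variables by q is evaluated in two ways: by homogeneity, and by
    [qconv_shiftl_prev] in one variable after the other. *)
Lemma qconv_rec k x y :
  (q^-1 ^+ k - q) * s k.+1 x y = (x + y) * s k x y + q^-1 * x * y * qconv_prev k x y.
Proof.
have h1 := qconv_homog k.+1 q^-1 x y.
have h2 := qconv_shiftl_prev k.+1 x (q^-1 * y).
have h3 := qconv_shiftl_prev k.+1 y x.
have h4 := qconv_shiftl_prev k y x.
rewrite /= in h2 h3.
have hp : qconv_prev k y x = qconv_prev k x y.
  by rewrite /qconv_prev; case: (k) => // n; rewrite qconvC.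
rewrite !(qconvC _ y) !(qconvC _ (q^-1 * y)) hp in h3 h4.
have := h2; rewrite h1 h3 h4 exprS => h5.
have -> : (q^-1 ^+ k - q) * s k.+1 x y =
  q * (q^-1 * q^-1 ^+ k * s k.+1 x y - s k.+1 x y) by field.
by rewrite h5; field.
Qed.

(** Coefficient form of E(x) E(y) = (1 + x)(1 + y) E(qx) E(qy), obtained from [qconv_rec] at k + 1
    on multiplying by q^(k+1). *)
Lemma qconv_qshift k x y :
  s k.+2 x y = q ^+ k.+2 * s k.+2 x y + q ^+ k.+1 * (x + y) * s k.+1 x y
               + q ^+ k * x * y * s k x y.
Proof.
have := qconv_rec k.+1 x y; rewrite /= => h.
have qi : q ^+ k.+1 != 0 by rewrite expf_neq0.
have : q ^+ k.+1 * ((q^-1 ^+ k.+1 - q) * s k.+2 x y) =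
   s k.+2 x y - q ^+ k.+2 * s k.+2 x y.
  by rewrite exprVn mulrA mulrBr mulfV // -exprSr mulrBl mul1r.
rewrite h => E; rewrite -addrA addrC; apply/eqP; rewrite -subr_eq -E; apply/eqP.
by rewrite exprS; field.
Qed.

End QExp.

(** * Convergence of the q-exponential and factorization of the product series *)

Section QExpCvg.
Local Open Scope classical_set_scope.
Local Open Scope ring_scope.
Variables (R : realType) (q : R).
Hypothesis hq : 0 < q < 1.
Implicit Types (t x y z : R) (n k N : nat).

Let q0 : 0 < q. Proof. by case/andP: hq. Qed.
Let q1 : q < 1. Proof. by case/andP: hq. Qed.
Local Notation e := (qexp_coef q).
Local Notation s := (qconv q).

Lemma qpochN_ge1 y n : 0 <= y -> 1 <= qpoch (- y) q n.
Proof.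
move=> y0; elim: n => [|n IH]; rewrite ?qpoch0 // qpochS.
by rewrite mulr_ege1 // mulNr opprK lerDl mulr_ge0 // exprn_ge0 // ltW.
Qed.

Lemma qpochN_le_expR y n : 0 <= y -> qpoch (- y) q n <= expR (y / (1 - q)).
Proof.
move=> y0.
have p0 : 0 < 1 - q by rewrite subr_gt0.
(* The partial geometric sum in the exponent makes the bound inductive, through 1 + v <= exp(v). *)
suff h : qpoch (- y) q n <= expR (y * (1 - q ^+ n) / (1 - q)).
  apply: le_trans h _; rewrite ler_expR ler_pM2r ?invr_gt0 //.
  by rewrite ler_piMr // lerBlDr lerDl exprn_ge0 // ltW.
elim: n => [|n IH]; first by rewrite qpoch0 expr0 subrr mulr0 mul0r expR0.
rewrite qpochS mulNr opprK.
have -> : y * (1 - q ^+ n.+1) / (1 - q) = y * (1 - q ^+ n) / (1 - q) + y * q ^+ n.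
  by rewrite exprS; field; rewrite gt_eqF.
rewrite expRD ler_pM ?expR_ge1Dx //.
  by rewrite (le_trans ler01) ?qpochN_ge1.
by rewrite addr_ge0 // mulr_ge0 // exprn_ge0 // ltW.
Qed.

Lemma sum_qconv_qshift N x y :
  \sum_(0 <= k < N.+2) s k x y = \sum_(0 <= k < N.+2) s k (q * x) (q * y)
    + (x + y) * \sum_(0 <= k < N.+1) s k (q * x) (q * y)
    + x * y * \sum_(0 <= k < N) s k (q * x) (q * y).
Proof.
elim: N => [|N IH].
  rewrite !big_nat_recr //= !big_geq // !qconv0 (qconv_homog q 1) expr1.
  have := qconv_rec hq 0 x y; rewrite /= expr0 qconv0 mulr0 addr0 mulr1 => h.
  by rewrite -h; ring.
rewrite big_nat_recr //= IH (qconv_qshift hq N x y).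
rewrite [X in _ = X + _ + _]big_nat_recr //=.
rewrite [X in _ = _ + _ * X + _]big_nat_recr //=.
rewrite [X in _ = _ + _ + _ * X]big_nat_recr //= !(qconv_homog q).
by ring.
Qed.

Lemma sum_qconv_ge0 N x y : 0 <= x -> 0 <= y -> 0 <= \sum_(0 <= k < N) s k x y.
Proof. by move=> x0 y0; apply: sumr_ge0 => k _; apply: qconv_ge0. Qed.

(** All terms being nonnegative, the three truncations in [sum_qconv_qshift] may be enlarged to the
    longest one. *)
Lemma sum_qconv_le N x y : 0 <= x -> 0 <= y ->
  \sum_(0 <= k < N) s k x y <=
  (1 + x) * (1 + y) * \sum_(0 <= k < N) s k (q * x) (q * y).
Proof.
move=> x0 y0.
have qx : 0 <= q * x by rewrite mulr_ge0 // ltW.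
have qy : 0 <= q * y by rewrite mulr_ge0 // ltW.
have xy : 0 <= x * y by rewrite mulr_ge0.
have xDy : 0 <= x + y by rewrite addr_ge0.
case: N => [|[|N]]; first by rewrite !big_geq // mulr0.
  by rewrite !big_nat1 !qconv0 mulr1 mulr_ege1 // lerDl.
rewrite sum_qconv_qshift.
set S2 := \sum_(0 <= k < N.+2) _; set S1 := \sum_(0 <= k < N.+1) _.
set S0 := \sum_(0 <= k < N) _.
have h1 : S1 <= S2 by rewrite /S2 big_nat_recr //= lerDl qconv_ge0.
have h0 : S0 <= S1 by rewrite /S1 big_nat_recr //= lerDl qconv_ge0.
have -> : (1 + x) * (1 + y) * S2 = S2 + (x + y) * S2 + x * y * S2 by ring.
by rewrite !lerD // ler_wpM2l // (le_trans h0).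
Qed.

Lemma sum_qconv_le_iter n N x y : 0 <= x -> 0 <= y ->
  \sum_(0 <= k < N) s k x y <= qpoch (- x) q n * qpoch (- y) q n *
     \sum_(0 <= k < N) s k (q ^+ n * x) (q ^+ n * y).
Proof.
move=> x0 y0; elim: n => [|n IH]; first by rewrite !qpoch0 !mul1r.
apply: le_trans IH _; rewrite !qpochS !mulNr !opprK.
set A := qpoch _ _ _; set B := qpoch _ _ _.
have A0 : 0 <= A by rewrite (le_trans ler01) ?qpochN_ge1.
have B0 : 0 <= B by rewrite (le_trans ler01) ?qpochN_ge1.
have -> S : A * (1 + x * q ^+ n) * (B * (1 + y * q ^+ n)) * S =
  A * B * ((1 + q ^+ n * x) * (1 + q ^+ n * y) * S) by ring.
apply: ler_wpM2l; first exact: mulr_ge0.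
by rewrite !exprS -!mulrA mulrA sum_qconv_le // mulr_ge0 // exprn_ge0 // ltW.
Qed.

(** Only the term k = 0 escapes the scaling; every other one gains a factor q^(nk) <= q^n. *)
Lemma sum_qconv_qX n N x y : 0 <= x -> 0 <= y ->
  \sum_(0 <= k < N) s k (q ^+ n * x) (q ^+ n * y) <=
  1 + q ^+ n * \sum_(0 <= k < N) s k x y.
Proof.
move=> x0 y0; have qn0 : 0 <= q ^+ n by rewrite exprn_ge0 // ltW.
case: N => [|N]; first by rewrite !big_geq // mulr0 addr0.
rewrite big_nat_recl // qconv0 lerD2l mulr_sumr big_nat_recl //.
rewrite ler_wpDl ?mulr_ge0 ?qconv0 //; apply: ler_sum => k _.
rewrite qconv_homog ler_wpM2r ?qconv_ge0 //.
by rewrite exprS ler_piMr // exprn_ile1 // exprn_ile1 // ltW.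
Qed.

Lemma cvgn_qX : (fun n => q ^+ n) @ \oo --> 0.
Proof. by apply: cvg_expr; rewrite ger0_norm // ltW. Qed.

(** A bootstrap: the finite sum S satisfies S <= B (1 + q^n S) for every n, and q^n tends to 0. No
    prior knowledge of convergence enters. *)
Lemma sum_qconv_bounded N x y : 0 <= x -> 0 <= y ->
  \sum_(0 <= k < N) s k x y <= expR (x / (1 - q)) * expR (y / (1 - q)).
Proof.
move=> x0 y0; set B := _ * _; set S := \sum_(0 <= k < N) _.
have B0 : 0 <= B by rewrite mulr_ge0 ?expR_ge0.
have h n : S <= B * (1 + q ^+ n * S).
  apply: le_trans (sum_qconv_le_iter n N x0 y0) _.
  have S0 : 0 <= \sum_(0 <= k < N) s k (q ^+ n * x) (q ^+ n * y).
    by rewrite sum_qconv_ge0 // mulr_ge0 // exprn_ge0 // ltW.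
  have px : 0 <= qpoch (- x) q n by rewrite (le_trans ler01) ?qpochN_ge1.
  have py : 0 <= qpoch (- y) q n by rewrite (le_trans ler01) ?qpochN_ge1.
  apply: ler_pM => //; [exact: mulr_ge0| |exact: sum_qconv_qX].
  by apply: ler_pM => //; apply: qpochN_le_expR.
have c : (fun n => B * (1 + q ^+ n * S)) @ \oo --> B * (1 + 0 * S).
  apply: cvgMl_tmp; apply: cvgD; first exact: cvg_cst.
  by apply: cvgMr_tmp; exact: cvgn_qX.
rewrite mul0r addr0 mulr1 in c.
by apply: (cvgr_to_ge c); apply: nearW.
Qed.

Lemma is_cvg_norm_qconv x y : cvgn [normed series (fun k => s k x y)].
Proof.
apply: nondecreasing_is_cvgn.
  by apply: nondecreasing_series => n _ _; exact: normr_ge0.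
exists (expR (`|x| / (1 - q)) * expR (`|y| / (1 - q))) => _ [n _ <-].
apply: le_trans (sum_qconv_bounded n (normr_ge0 x) (normr_ge0 y)).
by rewrite /series /=; apply: ler_sum => k _; exact: normr_qconv.
Qed.

Lemma is_cvg_qconv x y : cvgn (series (fun k => s k x y)).
Proof. exact/normed_cvg/is_cvg_norm_qconv. Qed.

(** The sum of the convolution series. It is identified with [qexp x * qexp y] in [C_E], by
    iterating C(x, y) = (1 + x)(1 + y) C(qx, qy) and using that C tends to 1 along (q^n x, q^n
    y). *)
Let C x y : R := limn (series (fun k => s k x y)).

Let cC x y : series (fun k => s k x y) @ \oo --> C x y.
Proof. exact: is_cvg_qconv. Qed.

Let C_qshift x y : C x y = (1 + x) * (1 + y) * C (q * x) (q * y).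
Proof.
have c1 u v : (fun n => series (fun k => s k u v) n.+1) @ \oo --> C u v.
  by rewrite (cvg_shiftS (series (fun k => s k u v))); exact: cC.
have c2 u v : (fun n => series (fun k => s k u v) n.+2) @ \oo --> C u v.
  by rewrite (cvg_shiftS (fun n => series (fun k => s k u v) n.+1)).
apply: (cvg_unique _ (c2 x y)) => //.
have -> : (fun n => series (fun k => s k x y) n.+2) =
    (fun n => series (fun k => s k (q * x) (q * y)) n.+2
      + (x + y) * series (fun k => s k (q * x) (q * y)) n.+1
      + x * y * series (fun k => s k (q * x) (q * y)) n).
  by apply/funext => n; rewrite /series /= sum_qconv_qshift.
have -> : (1 + x) * (1 + y) * C (q * x) (q * y) = C (q * x) (q * y)
  + (x + y) * C (q * x) (q * y) + x * y * C (q * x) (q * y) by ring.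
apply: cvgD; [apply: cvgD|].
- exact: c2.
- by apply: cvgMl_tmp; exact: c1.
- by apply: cvgMl_tmp; exact: cC.
Qed.

Let C_qpoch n x y :
  C x y = qpoch (- x) q n * qpoch (- y) q n * C (q ^+ n * x) (q ^+ n * y).
Proof.
elim: n => [|n ->]; first by rewrite !qpoch0 !mul1r.
by rewrite C_qshift !qpochS !exprS -!mulrA; ring.
Qed.

Let C_cvg1 x y : (fun n => C (q ^+ n * x) (q ^+ n * y)) @ \oo --> (1 : R).
Proof.
set B := expR (`|x| / (1 - q)) * expR (`|y| / (1 - q)).
have h n : `|C (q ^+ n * x) (q ^+ n * y) - 1| <= q ^+ n * B.
  have c : (fun N => `|series (fun k => s k (q ^+ n * x) (q ^+ n * y)) N.+1 - 1|)
     @ \oo --> `|C (q ^+ n * x) (q ^+ n * y) - 1|.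
    apply: cvg_norm; apply: cvgB; last exact: cvg_cst.
    by rewrite (cvg_shiftS (series _)); exact: cC.
  apply: (cvgr_to_le c); apply: nearW => N.
  rewrite /series /= big_nat_recl // qconv0 addrAC subrr add0r.
  apply: le_trans (ler_norm_sum _ _ _) _.
  apply: (@le_trans _ _ (q ^+ n * \sum_(0 <= k < N) s k.+1 `|x| `|y|)).
    rewrite mulr_sumr; apply: ler_sum => k _; rewrite qconv_homog normrM.
    apply: ler_pM => //; last exact: normr_qconv.
    have Q0 : 0 <= q ^+ n by rewrite exprn_ge0 // ltW.
    have Q1 : q ^+ n <= 1 by rewrite exprn_ile1 // ltW.
    by rewrite normrX ger0_norm // exprS ler_piMr // exprn_ile1.
  rewrite ler_wpM2l ?exprn_ge0 ?(ltW q0) //.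
  apply: le_trans (sum_qconv_bounded N.+1 (normr_ge0 x) (normr_ge0 y)).
  by rewrite [leRHS]big_nat_recl // lerDr qconv0.
have c0 : (fun n => q ^+ n * B) @ \oo --> 0.
  by rewrite -(mul0r B); apply: cvgMr_tmp; exact: cvgn_qX.
apply/cvgrPdist_le => eps eps0.
have /cvgrPdist_le /(_ _ eps0) := c0; apply: filterS => n.
rewrite sub0r normrN => hn; rewrite distrC.
by apply: le_trans (h n) (le_trans (ler_norm _) hn).
Qed.

(** For y = 0 the iterated functional equation writes the finite product as C(x, 0) / C(q^n x, 0)
    for large n, so the infinite product converges whatever the sign of x. *)
Let qpoch_cvg_C x : (fun n => qpoch (- x) q n) @ \oo --> C x 0.
Proof.
have c : (fun n => C x 0 / C (q ^+ n * x) (q ^+ n * 0)) @ \oo --> C x 0.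
  rewrite -{2}[C x 0]divr1; apply: cvgMl_tmp; apply: cvgV; first exact: oner_neq0.
  exact: (C_cvg1 x 0).
apply: cvg_trans c; apply: near_eq_cvg.
have /cvgrPdist_lt /(_ _ ltr01) := C_cvg1 x 0; apply: filterS => n h.
have n0 : C (q ^+ n * x) (q ^+ n * 0) != 0.
  by apply: contraTneq h => ->; rewrite subr0 normr1 ltxx.
by rewrite [X in X / _ = _](C_qpoch n) mulfK // oppr0 qpoch0l mulr1.
Qed.

(** The sign is chosen so that the power series in z has positive coefficients. *)
Definition qexp z : R := qpoch_inf (- z) q.

Lemma qpoch_cvg z : (fun n => qpoch (- z) q n) @ \oo --> qexp z.
Proof. by rewrite /qexp /qpoch_inf (cvg_lim _ (@qpoch_cvg_C z)) //. Qed.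

Let C_E x y : C x y = qexp x * qexp y.
Proof.
have c : (fun n => qpoch (- x) q n * qpoch (- y) q n * C (q ^+ n * x) (q ^+ n * y))
   @ \oo --> qexp x * qexp y * 1.
  apply: cvgM; last exact: C_cvg1.
  by apply: cvgM; exact: qpoch_cvg.
rewrite mulr1 in c; rewrite -(cvg_lim _ c) //.
under eq_fun do rewrite -C_qpoch.
by rewrite lim_cst.
Qed.

Lemma qexp0 : qexp 0 = 1.
Proof.
rewrite /qexp /qpoch_inf oppr0.
have -> : qpoch 0 q = fun=> 1 :> R by apply/funext => n; rewrite qpoch0l.
by rewrite lim_cst.
Qed.

Lemma qexp_qpoch n z : qexp z = qpoch (- z) q n * qexp (q ^+ n * z).
Proof.
have := C_qpoch n z 0; rewrite !C_E mulr0 qexp0 !mulr1 oppr0 => ->.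
by rewrite qpoch0l mulr1.
Qed.

Lemma qexp_qshift z : qexp z = (1 + z) * qexp (q * z).
Proof. by rewrite (qexp_qpoch 1) qpochS qpoch0 mul1r expr0 expr1 mulr1 opprK. Qed.

Lemma qexp_ge1 z : 0 <= z -> 1 <= qexp z.
Proof.
move=> z0; apply: (cvgr_to_ge (@qpoch_cvg z)).
by apply: nearW => n; exact: qpochN_ge1.
Qed.

Lemma qpochN_le_qexp n z : 0 <= z -> qpoch (- z) q n <= qexp z.
Proof.
move=> z0; rewrite (qexp_qpoch n) ler_peMr ?qexp_ge1 //.
  by rewrite (le_trans ler01) ?qpochN_ge1.
by rewrite mulr_ge0 // exprn_ge0 // ltW.
Qed.

(** The tail of the product tends to 1, so the sign and the vanishing of [qexp z] depend on finitely
    many factors only. *)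
Let qexp_qX_gt0 z : exists n, 0 < qexp (q ^+ n * z).
Proof.
have c : (fun n => qexp (q ^+ n * z)) @ \oo --> (1 : R).
  apply: cvg_trans (@C_cvg1 z 0); apply: near_eq_cvg.
  by apply: nearW => n; rewrite C_E mulr0 qexp0 mulr1.
have [n _ /(_ n) hn] := cvgr_gt _ c _ (@ltr01 R).
by exists n; apply: hn => /=.
Qed.

Lemma qexp_gt0 z : (forall n, 0 < 1 + z * q ^+ n) -> 0 < qexp z.
Proof.
move=> h.
have [n hn] := qexp_qX_gt0 z.
rewrite (qexp_qpoch n) mulr_gt0 //.
by rewrite /qpoch prodr_gt0 // => i _; rewrite mulNr opprK.
Qed.

Lemma qexp_neq0 z : (forall n, 1 + z * q ^+ n != 0) -> qexp z != 0.
Proof.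
move=> h.
have [n hn] := qexp_qX_gt0 z.
rewrite (qexp_qpoch n) mulf_neq0 ?(gt_eqF hn) //.
by rewrite /qpoch prodf_seq_neq0; apply/allP => i _ /=; rewrite mulNr opprK h.
Qed.

Lemma qconv_cvg x y : series (fun k => s k x y) @ \oo --> qexp x * qexp y.
Proof. by rewrite -C_E; exact: cC. Qed.

Lemma qexp_cvg x : series (fun k => e k * x ^+ k) @ \oo --> qexp x.
Proof.
have -> : (fun k => e k * x ^+ k) = (fun k => s k x 0).
  by apply/funext => k; rewrite qconv_r0.
by rewrite -[qexp x]mulr1 -qexp0; exact: qconv_cvg.
Qed.

Lemma sum_qconv_le_qexp N x y : 0 <= x -> 0 <= y ->
  \sum_(0 <= k < N) s k x y <= qexp x * qexp y.
Proof.
move=> x0 y0; apply: (cvgr_to_ge (@qconv_cvg x y)).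
exists N => // n /= Nn; rewrite /series /= (@big_cat_nat _ _ _ N 0 n) //= lerDl.
by apply: sumr_ge0 => k _; exact: qconv_ge0.
Qed.

End QExpCvg.

(** * Exponentials of [arsinh x] *)

Section ArsinhExp.
Variable R : realType.
Implicit Type x : R.

Lemma expR_arsinh_sub x : expR (arsinh x) - expR (- arsinh x) = 2 * x.
Proof. by rewrite -[in RHS](arsinhK x) /sinh; field. Qed.

Lemma expR_arsinh_mul x : expR (arsinh x) * expR (- arsinh x) = 1.
Proof. by rewrite -expRD subrr expR0. Qed.

Lemma expR_arsinh_add_le x :
  expR (arsinh x) + expR (- arsinh x) <= 2 * (1 + `|x|).
Proof.
have -> : expR (arsinh x) + expR (- arsinh x) = 2 * (expR (arsinh x) - x).
  by have := expR_arsinh_sub x; lra.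
rewrite ler_pM2l // expR_arsinh addrAC subrr add0r.
rewrite -(ler_pXn2r (n := 2)) ?nnegrE ?sqrtr_ge0 ?addr_ge0 //.
rewrite sqr_sqrtr ?addr_ge0 ?sqr_ge0 // -(real_normK (num_real x)).
by have := normr_ge0 x; nra.
Qed.

End ArsinhExp.

(** * The generating function of the q^-1-Hermite polynomials and its majorant *)

Section GeneratingFunction.
Local Open Scope classical_set_scope.
Local Open Scope ring_scope.
Variables (R : realType) (q : R).
Hypothesis hq : 0 < q < 1.
Implicit Types (t x y z : R) (n k N : nat).

Let q0 : 0 < q. Proof. by case/andP: hq. Qed.
Let q1 : q < 1. Proof. by case/andP: hq. Qed.
Let qN0 : q != 0. Proof. by rewrite gt_eqF. Qed.
Local Notation e := (qexp_coef q).
Local Notation s := (qconv q).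
Local Notation E := (qexp q).

(** The coefficient of t^k in [qgen t x]; by [qherm_qinvHermite] it is e_k 2^k h_k(x). *)
Definition qherm k x : R := s k (expR (arsinh x)) (- expR (- arsinh x)).

Definition qherm_prev k x : R := if k is k'.+1 then qherm k' x else 0.

Lemma qherm0 x : qherm 0 x = 1.
Proof. exact: qconv0. Qed.

Lemma qherm_rec k x :
  (q^-1 ^+ k - q) * qherm k.+1 x = 2 * x * qherm k x - q^-1 * qherm_prev k x.
Proof.
rewrite /qherm qconv_rec // expR_arsinh_sub mulrN -(mulrA q^-1).
by rewrite expR_arsinh_mul mulr1 mulNr; case: k => [|k].
Qed.

Lemma qherm_qinvHermite k x : qherm k x = e k * 2 ^+ k * qinvHermite q k x.
Proof.
rewrite /qinvHermite.
(* A three-term recurrence needs two consecutive values, hence a claim on the whole pair; its first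
   entry at k = 0 is h_(-1) = 0. *)
suff : qherm k x = e k * 2 ^+ k * (qinvHermite_pair q k x).2 /\
  (if k is k'.+1 then qherm k' x = e k' * 2 ^+ k' * (qinvHermite_pair q k x).1
   else (qinvHermite_pair q k x).1 = 0) by case.
elim: k => [|k [IH1 IH2]].
  by rewrite qherm0 /= qexp_coef0 expr0 !mulr1.
move: IH1 IH2 => /=; case: (qinvHermite_pair q k x) => h' h /= IH1 IH2.
split=> //.
have P0 : 0 < q^-1 ^+ k - q.
  rewrite subr_gt0 (lt_le_trans q1) // exprn_ege1 // invf_ge1 //; exact: ltW.
apply: (mulfI (lt0r_neq0 P0)); rewrite qherm_rec IH1.
have ek : (q^-1 ^+ k - q) * e k.+1 = e k.
  have := qexp_coefS hq k; have qk : q ^+ k != 0 by rewrite expf_neq0.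
  move/(congr1 (fun z => z * q^-1 ^+ k)); rewrite exprVn mulfK // => <-.
  by rewrite exprS; field.
have -> z : (q^-1 ^+ k - q) * (e k.+1 * 2 ^+ k.+1 * z) =
  (q^-1 ^+ k - q) * e k.+1 * (2 ^+ k.+1 * z) by ring.
rewrite ek.
case: k IH1 IH2 P0 ek => [|k] IH1 IH2 P0 ek.
  by rewrite IH2 /= expr0; field.
have {}IH2 : qherm_prev k.+1 x = e k * 2 ^+ k * h' by [].
have : e k.+1 * (q^-1 ^+ k.+1 - 1) = q^-1 * e k by exact: qexp_coefSV.
rewrite IH2 exprVn !exprS => h1.
have -> : q^-1 * (e k * 2 ^+ k * h') = q^-1 * e k * (2 ^+ k * h') by ring.
by rewrite -h1; field; rewrite qN0 expf_neq0.
Qed.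

Definition qgen t x : R :=
  E (t * expR (arsinh x)) * E (- (t * expR (- arsinh x))).

(** The generating function with every term made nonnegative; it bounds the sums of absolute values
    in the series of [qgen t x]. *)
Definition qmaj t x : R :=
  E (`|t| * expR (arsinh x)) * E (`|t| * expR (- arsinh x)).

Lemma qgen0 x : qgen 0 x = 1.
Proof. by rewrite /qgen !mul0r oppr0 qexp0 // mulr1. Qed.

Lemma qgen_cvg t x : series (fun k => t ^+ k * qherm k x) @ \oo --> qgen t x.
Proof.
have -> : (fun k => t ^+ k * qherm k x) =
    (fun k => s k (t * expR (arsinh x)) (- (t * expR (- arsinh x)))).
  by apply/funext => k; rewrite -mulrN qconv_homog.
exact: qconv_cvg.
Qed.

Lemma sum_normr_qherm_le N t x :
  \sum_(0 <= k < N) `|t ^+ k * qherm k x| <= qmaj t x.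
Proof.
apply: le_trans (sum_qconv_le_qexp hq N _ _); last 2 first.
- by rewrite mulr_ge0 ?expR_ge0.
- by rewrite mulr_ge0 ?expR_ge0.
apply: ler_sum => k _; rewrite qconv_homog normrM normrX ler_wpM2l ?exprn_ge0 //.
apply: le_trans (normr_qconv hq _ _ _) _.
by rewrite normrN !ger0_norm ?expR_ge0.
Qed.

Lemma normr_qgen_le t x : `|qgen t x| <= qmaj t x.
Proof.
have c := @qgen_cvg t x; apply: (cvgr_to_le (cvg_norm c)).
apply: nearW => n; apply: le_trans (sum_normr_qherm_le n t x).
exact: ler_norm_sum.
Qed.

Lemma normr_qherm_le k x : `|qherm k x| <= qmaj 1 x.
Proof.
apply: le_trans (sum_normr_qherm_le k.+1 1 x).
rewrite big_nat_recr //= expr1n mul1r lerDr.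
exact: sumr_ge0.
Qed.

Definition qgen_factor t x : R := 1 + 2 * x * t - t ^+ 2.

Lemma qgen_factorE t x :
  qgen_factor t x = (1 + t * expR (arsinh x)) * (1 - t * expR (- arsinh x)).
Proof.
rewrite /qgen_factor -expR_arsinh_sub.
have := expR_arsinh_mul x; set A := expR _; set B := expR _ => AB.
have -> : t ^+ 2 = t ^+ 2 * (A * B) by rewrite AB mulr1.
by ring.
Qed.

Lemma qgen_qshift t x : qgen t x = qgen_factor t x * qgen (q * t) x.
Proof.
rewrite /qgen (qexp_qshift hq (t * _)) (qexp_qshift hq (- (t * _))).
by rewrite qgen_factorE -!mulrA !mulrN; ring.
Qed.

Lemma measurable_qgen t : measurable_fun [set: R] (qgen t).
Proof.
(* The factors for e^u and e^(-u) are paired, so that [qgen t] is a pointwise limit of polynomials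
   in x. *)
apply: (@measurable_fun_cvg _ _ _ _
  (fun n x => \prod_(0 <= j < n) qgen_factor (t * q ^+ j) x)) => [n|x _].
  elim: n => [|n IH].
    by under eq_fun do rewrite big_geq //; exact: measurable_cst.
  under eq_fun do rewrite big_nat_recr //=.
  apply: measurable_funM => //; rewrite /qgen_factor.
  apply: measurable_funB => //; apply: measurable_funD => //.
  by apply: measurable_funM => //; apply: measurable_funM.
have -> : (fun n => \prod_(0 <= j < n) qgen_factor (t * q ^+ j) x) =
  (fun n => qpoch (- (t * expR (arsinh x))) q n *
            qpoch (- - (t * expR (- arsinh x))) q n).
  apply/funext => n; rewrite /qpoch -big_split /=; apply: eq_bigr => j _.
  by rewrite qgen_factorE; ring.
by apply: cvgM; exact: qpoch_cvg.
Qed.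

Lemma qinvHermite_poly k :
  exists p : {poly R}, forall x, qinvHermite q k x = p.[x].
Proof.
rewrite /qinvHermite.
suff [p [p' hp]] : exists p p' : {poly R}, forall x,
  qinvHermite_pair q k x = (p'.[x], p.[x]) by exists p => x; rewrite hp.
elim: k => [|k [p [p' IH]]].
  by exists 1, 0 => x; rewrite /= !hornerE.
exists ('X * p - (4^-1 * (q ^- k - 1)) *: p'), p => x /=.
by rewrite IH !hornerE.
Qed.

Lemma qinvHermiteS k x : qinvHermite q k.+2 x =
  x * qinvHermite q k.+1 x - 4^-1 * (q ^- k.+1 - 1) * qinvHermite q k x.
Proof. by rewrite /qinvHermite /=; case: (qinvHermite_pair q k x). Qed.

(** Since e^u e^(-u) = 1 and e^u + e^(-u) <= 2(1 + |x|), a pair of factors grows only linearly in x,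
    so one product in 1 + |x| bounds both. *)
Lemma qpoch_pair_le n t x : 0 <= t ->
  qpoch (- (t * expR (arsinh x))) q n * qpoch (- (t * expR (- arsinh x))) q n
   <= qpoch (- ((t ^+ 2 + 2 * t) * (1 + `|x|))) q n.
Proof.
move=> t0; rewrite /qpoch -big_split /=; apply: ler_prod => j _.
have qj0 : 0 <= q ^+ j by rewrite exprn_ge0 // ltW.
have qj1 : q ^+ j <= 1 by rewrite exprn_ile1 // ltW.
rewrite !mulNr !opprK.
have := expR_arsinh_mul x; have := expR_arsinh_add_le x.
have := expR_ge0 (- arsinh x); have := expR_ge0 (arsinh x).
set A := expR _; set B := expR _ => A0 B0 AB AB1.
apply/andP; split; first by rewrite mulr_ge0 // addr_ge0 // !mulr_ge0.
have -> : (1 + t * A * q ^+ j) * (1 + t * B * q ^+ j) =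
  1 + q ^+ j * (t * (A + B) + t ^+ 2 * q ^+ j * (A * B)) by ring.
rewrite AB1 mulr1 lerD2l [leRHS]mulrC ler_wpM2l // mulrDl addrC lerD //.
  have t20 : 0 <= t ^+ 2 by rewrite exprn_ge0.
  apply: (@le_trans _ _ (t ^+ 2 * 1)); first by rewrite ler_wpM2l.
  by rewrite ler_wpM2l // lerDl.
by rewrite [2 * t]mulrC -mulrA ler_wpM2l.
Qed.

End GeneratingFunction.

(** * Bounding a product of three majorants by one q-exponential *)

Section Majorant.
Local Open Scope classical_set_scope.
Local Open Scope ring_scope.
Variables (R : realType) (r : R).
Hypothesis hr : 0 < r < 1.
Implicit Types (t x y z : R) (n k N : nat).

Let r0 : 0 < r. Proof. by case/andP: hr. Qed.
Let r1 : r < 1. Proof. by case/andP: hr. Qed.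

Lemma cube_lt01 : 0 < r ^+ 3 < 1.
Proof. by rewrite exprn_gt0 //= exprn_ilt1 // ltW. Qed.

(** Each cubed factor 1 + y r^(3j) is compared with three consecutive factors in base r, at
    exponents 3j, 3j + 1 and 3j + 2; dividing y by r^2 makes all three large enough. *)
Lemma qpoch_cube_le n y : 0 <= y ->
  qpoch (- y) (r ^+ 3) n ^+ 3 <= qpoch (- (y / r ^+ 2)) r (3 * n).
Proof.
move=> y0; elim: n => [|n IH]; first by rewrite muln0 !qpoch0 expr1n.
have -> : (3 * n.+1 = (3 * n).+3)%N by rewrite mulnS.
have mulA4 (a b c d : R) : a * b * c * d = a * (b * c * d) by ring.
rewrite !qpochS exprMn [leRHS]mulA4 ler_pM //.
- by rewrite exprn_ge0 // (le_trans ler01) // qpochN_ge1 // cube_lt01.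
- by rewrite exprn_ge0 // mulNr opprK addr_ge0 // mulr_ge0 // !exprn_ge0 // ltW.
have rn : 0 <= r ^+ (3 * n) by rewrite exprn_ge0 // ltW.
rewrite !mulNr !opprK -exprM; set v := y * r ^+ (3 * n).
have v0 : 0 <= v by rewrite mulr_ge0.
have h m : (m <= 2)%N -> 1 + v <= 1 + y / r ^+ 2 * r ^+ (3 * n + m).
  move=> m2; rewrite lerD2l /v exprD.
  have -> : y / r ^+ 2 * (r ^+ (3 * n) * r ^+ m) = v * (r ^+ m / r ^+ 2).
    by rewrite /v; ring.
  rewrite ler_peMr // ler_pdivlMr ?exprn_gt0 // mul1r.
  by rewrite ler_wiXn2l // ltW.
have h0 := h 0%N isT; have h1 := h 1%N isT; have h2 := h 2%N isT.
rewrite addn0 in h0; rewrite addn1 in h1; rewrite addn2 in h2.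
have -> : (1 + v) ^+ 3 = (1 + v) * (1 + v) * (1 + v) by ring.
have F0 : 0 <= 1 + v by rewrite addr_ge0.
by apply: ler_pM; rewrite ?mulr_ge0 //; apply: ler_pM.
Qed.

(** By [qpoch_pair_le] each majorant is controlled by a product with parameter t^2 + 2|t|. The sum
    [c] of the three parameters serves for all of them, which leaves a cube for [qpoch_cube_le]. *)
Lemma qmaj3_le t1 t2 t3 : exists2 B, 0 <= B &
  forall x, qmaj (r ^+ 3) t1 x * qmaj (r ^+ 3) t2 x * qmaj (r ^+ 3) t3 x
            <= qexp r (B * (1 + `|x|)).
Proof.
pose b t : R := `|t| ^+ 2 + 2 * `|t|.
have b0 t : 0 <= b t by rewrite addr_ge0 ?mulr_ge0 ?exprn_ge0.
pose c := b t1 + b t2 + b t3.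
have c0 : 0 <= c by rewrite !addr_ge0.
exists (c / r ^+ 2); first by rewrite divr_ge0 // exprn_ge0 // ltW.
move=> x.
have Pc t : (fun n => qpoch (- (`|t| * expR (arsinh x))) (r ^+ 3) n *
  qpoch (- (`|t| * expR (- arsinh x))) (r ^+ 3) n) @ \oo --> qmaj (r ^+ 3) t x.
  by apply: cvgM; apply: qpoch_cvg; exact: cube_lt01.
apply: (cvgr_to_le (cvgM (cvgM (Pc t1) (Pc t2)) (Pc t3))); apply: nearW => n /=.
have y0 : 0 <= c * (1 + `|x|) by rewrite mulr_ge0 // addr_ge0.
have y0' : 0 <= c / r ^+ 2 * (1 + `|x|).
  by rewrite mulr_ge0 ?addr_ge0 // divr_ge0 // exprn_ge0 // ltW.
apply: le_trans (qpochN_le_qexp hr (3 * n) y0').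
have := qpoch_cube_le n y0; rewrite mulrAC; apply: le_trans.
have h t : b t <= c ->
   0 <= qpoch (- (`|t| * expR (arsinh x))) (r ^+ 3) n *
        qpoch (- (`|t| * expR (- arsinh x))) (r ^+ 3) n
     <= qpoch (- (c * (1 + `|x|))) (r ^+ 3) n.
  move=> tc; apply/andP; split.
    by rewrite mulr_ge0 // (le_trans ler01) // qpochN_ge1 // ?cube_lt01 // mulr_ge0 ?expR_ge0.
  apply: le_trans (qpoch_pair_le cube_lt01 n x (normr_ge0 t)) _.
  apply: ler_prod => j _; have rj0 : 0 <= (r ^+ 3) ^+ j by rewrite !exprn_ge0 // ltW.
  rewrite !mulNr !opprK addr_ge0 //=; last first.
    by rewrite mulr_ge0 // mulr_ge0 ?addr_ge0 ?mulr_ge0 ?exprn_ge0.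
  by rewrite lerD2l ler_wpM2r // ler_wpM2r // addr_ge0.
have bc t : b t = b t1 \/ b t = b t2 \/ b t = b t3 -> b t <= c.
  have := (b0 t1, b0 t2, b0 t3) => -[[z1 z2] z3].
  by rewrite /c; case=> [->|[->|->]]; lra.
have /andP[a1 l1] := h t1 (bc t1 (or_introl erefl)).
have /andP[a2 l2] := h t2 (bc t2 (or_intror (or_introl erefl))).
have /andP[a3 l3] := h t3 (bc t3 (or_intror (or_intror erefl))).
have cube (Q : R) : Q ^+ 3 = Q * Q * Q by ring.
rewrite [leRHS]cube.
by apply: ler_pM => //; [exact: mulr_ge0|exact: ler_pM].
Qed.
End Majorant.

(** * Integration of functions and series against a nonnegative weight *)

Section WeightedIntegral.
Local Open Scope classical_set_scope.
Local Open Scope ring_scope.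
Variables (R : realType) (w : R -> R).
Hypothesis mw : measurable_fun [set: R] w.
Hypothesis w_ge0 : forall x, 0 <= w x.
Implicit Types (f g D : R -> R).

Local Notation mu := (@lebesgue_measure R).

Definition wintegrable f : Prop :=
  mu.-integrable [set: R] (EFin \o (fun x => f x * w x)).

Definition wint f : R := \int[mu]_x (f x * w x).

Lemma eq_wintegrable f g : f =1 g -> wintegrable f -> wintegrable g.
Proof. by move=> /funext ->. Qed.

Lemma eq_wint f g : f =1 g -> wint f = wint g.
Proof. by move=> /funext ->. Qed.

Lemma wintegrableD f g :
  wintegrable f -> wintegrable g -> wintegrable (fun x => f x + g x).
Proof.
move=> fi gi; have := integrableD measurableT fi gi.
by apply: eq_integrable => // x _ /=; rewrite -EFinD mulrDl.
Qed.

Lemma wintegrableZ (c : R) f : wintegrable f -> wintegrable (fun x => c * f x).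
Proof.
move=> fi; have := integrableZl measurableT c fi.
by apply: eq_integrable => // x _ /=; rewrite -EFinM mulrA.
Qed.

Lemma wintD f g : wintegrable f -> wintegrable g ->
  wint (fun x => f x + g x) = wint f + wint g.
Proof.
move=> fi gi; rewrite /wint -RintegralD //.
by apply: eq_Rintegral => x _; rewrite mulrDl.
Qed.

Lemma wintZ (c : R) f : wintegrable f -> wint (fun x => c * f x) = c * wint f.
Proof.
move=> fi; rewrite /wint -RintegralZl //.
by apply: eq_Rintegral => x _; rewrite mulrA.
Qed.

Lemma wintegrable_sum n (F : nat -> R -> R) : (forall k, wintegrable (F k)) ->
  wintegrable (fun x => \sum_(0 <= k < n) F k x).
Proof.
move=> Fi; elim: n => [|n IH].
  apply: (eq_wintegrable (f := fun x => 0 * F 0%N x)); last exact: wintegrableZ.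
  by move=> x; rewrite big_geq // mul0r.
apply: eq_wintegrable (wintegrableD IH (Fi n)) => x.
by rewrite big_nat_recr.
Qed.

Lemma wint_sum n (F : nat -> R -> R) : (forall k, wintegrable (F k)) ->
  wint (fun x => \sum_(0 <= k < n) F k x) = \sum_(0 <= k < n) wint (F k).
Proof.
move=> Fi; elim: n => [|n IH].
  transitivity (wint (fun x => 0 * F 0%N x)); last by rewrite wintZ // mul0r big_geq.
  by apply: eq_wint => x; rewrite big_geq // mul0r.
rewrite big_nat_recr //= -IH -wintD //; last exact: wintegrable_sum.
by apply: eq_wint => x; rewrite big_nat_recr.
Qed.

Lemma wint_ge0 f : (forall x, 0 <= f x) -> 0 <= wint f.
Proof. by move=> f0; apply: Rintegral_ge0 => x _; exact: mulr_ge0. Qed.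

Lemma le_wint f g : wintegrable f -> wintegrable g -> (forall x, f x <= g x) ->
  wint f <= wint g.
Proof.
by move=> fi gi fg; apply: le_Rintegral => // x _; rewrite ler_wpM2r.
Qed.

Lemma wintegrable_le f D : measurable_fun [set: R] f -> wintegrable D ->
  (forall x, `|f x| <= D x) -> wintegrable f.
Proof.
move=> mf Di fD; apply: le_integrable Di => //.
  by apply/measurable_EFinP; exact: measurable_funM.
move=> x _ /=; rewrite lee_fin !normrM ler_wpM2r //.
exact: le_trans (fD x) (ler_norm _).
Qed.

(** Dominated convergence for the partial sums, which [D] bounds through the sums of absolute
    values. *)
Lemma wint_series_cvg (f : nat -> R -> R) (F : R -> R) D :
  (forall k, measurable_fun [set: R] (f k)) -> wintegrable D ->
  (forall n x, \sum_(0 <= k < n) `|f k x| <= D x) ->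
  (forall x, series (f ^~ x) @ \oo --> F x) ->
  wintegrable F /\ series (fun k => wint (f k)) @ \oo --> wint F.
Proof.
move=> mf Di fD fF.
have mS n : measurable_fun [set: R] (fun x => series (f ^~ x) n).
  by rewrite /series /=; apply: measurable_sum => k; exact: mf.
have mF : measurable_fun [set: R] F.
  by apply: (measurable_fun_cvg mS) => x _; exact: fF.
have SD n x : `|series (f ^~ x) n| <= D x.
  by apply: le_trans (fD n x); exact: ler_norm_sum.
have FD x : `|F x| <= D x.
  by apply: (cvgr_to_le (cvg_norm (fF x))); apply: nearW => n; exact: SD.
have Fi : wintegrable F by exact: wintegrable_le FD.
split=> //.
have fi k : wintegrable (f k).
  apply: (wintegrable_le (mf k) Di) => x; apply: le_trans (fD k.+1 x).
  by rewrite big_nat_recr //= lerDr sumr_ge0.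
have dc := @dominated_cvg _ _ _ mu _ measurableT
  (fun n x => (series (f ^~ x) n * w x)%:E) (fun x => (F x * w x)%:E)
  (fun x => (D x * w x)%:E).
have {dc} : (\int[mu]_x (series (f ^~ x) n * w x)%:E)%E @[n --> \oo] -->
    (\int[mu]_x (F x * w x)%:E)%E.
  apply: dc => //.
  - by move=> n; apply/measurable_EFinP; exact: measurable_funM (mS n) mw.
  - move=> x _; apply: cvg_EFin; first by apply: nearW.
    by apply: cvgMr_tmp; exact: fF.
  - by move=> n x _; rewrite lee_fin normrM (ger0_norm (w_ge0 x)) ler_wpM2r.
have fin G : wintegrable G -> (\int[mu]_x (G x * w x)%:E)%E = (wint G)%:E.
  by move=> Gi; rewrite /wint /Rintegral fineK // integrable_fin_num.
rewrite fin //.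
have -> : (fun n => \int[mu]_x (series (f ^~ x) n * w x)%:E)%E =
   EFin \o series (fun k => wint (f k)).
  apply/funext => n; rewrite /= (fin (fun x => series (f ^~ x) n)).
    by rewrite wint_sum.
  exact: wintegrable_sum.
by move/fine_cvgP => [].
Qed.

(** Monotone convergence. This is the source of the dominating functions required by
    [wint_series_cvg]. *)
Lemma wintegrable_series (f : nat -> R -> R) (F : R -> R) (M : R) :
  (forall k, wintegrable (f k)) -> (forall k, measurable_fun [set: R] (f k)) ->
  (forall k x, 0 <= f k x) ->
  (forall x, series (f ^~ x) @ \oo --> F x) ->
  (forall n, \sum_(0 <= k < n) wint (f k) <= M) -> wintegrable F.
Proof.
move=> fi mf f0 fF bM.
have mS n : measurable_fun [set: R] (fun x => series (f ^~ x) n).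
  by rewrite /series /=; apply: measurable_sum => k; exact: mf.
have mF : measurable_fun [set: R] F.
  by apply: (measurable_fun_cvg mS) => x _; exact: fF.
have F0 x : 0 <= F x.
  by apply: (cvgr_to_ge (fF x)); apply: nearW => n; exact: sumr_ge0.
apply/integrableP; split; first by apply/measurable_EFinP; exact: measurable_funM.
have -> : (\int[mu]_x `|(EFin \o (fun x => F x * w x)%R) x|)%E =
          (\int[mu]_x (limn (fun n => (series (f ^~ x) n * w x)%:E)))%E.
  apply: eq_integral => x _ /=; rewrite ger0_norm ?mulr_ge0 //.
  apply/esym/cvg_lim => //; apply: cvg_EFin; first by apply: nearW.
  by apply: cvgMr_tmp; exact: fF.
have mc := @cvg_monotone_convergence _ _ _ mu _ measurableT
  (fun n x => (series (f ^~ x) n * w x)%:E).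
have {}mc : (\int[mu]_x (series (f ^~ x) n * w x)%:E)%E @[n --> \oo] -->
    (\int[mu]_x limn (fun n => (series (f ^~ x) n * w x)%:E))%E.
  apply: mc.
  - by move=> n; apply/measurable_EFinP; exact: measurable_funM (mS n) mw.
  - by move=> n x _; rewrite lee_fin mulr_ge0 // sumr_ge0.
  - move=> x _ m n mn; rewrite lee_fin ler_wpM2r //.
    by apply: (@nondecreasing_series _ (f ^~ x) predT 0%N) => //.
rewrite -(cvg_lim _ mc) //.
apply: (@le_lt_trans _ _ M%:E); last exact: ltry.
apply: lime_le; first by apply/cvg_ex; eexists; exact: mc.
apply: nearW => n.
have -> : (\int[mu]_x (series (f ^~ x) n * w x)%:E)%E =
  (wint (fun x => series (f ^~ x) n))%:E.
  by rewrite /wint /Rintegral fineK // integrable_fin_num //; exact: wintegrable_sum.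
by rewrite lee_fin wint_sum.
Qed.

End WeightedIntegral.

Lemma exists_root (R : realType) (q : R) n : 0 < q < 1 ->
  exists2 z : R, 0 < z < 1 & z ^+ n.+1 = q.
Proof.
case/andP=> q0 q1; exists (expR (ln q / n.+1%:R)).
  rewrite expR_gt0 /= -expR0 ltr_expR pmulr_llt0 ?invr_gt0 ?ltr0n //.
  by rewrite ln_lt0 // q0 q1.
by rewrite -expRM_natl mulrCA divff ?pnatr_eq0 // mulr1 lnK.
Qed.

(** Reduces absolute moments to even ones, which are integrals of polynomials. *)
Lemma expr_onenorm_le (R : realType) (x : R) k m : (k <= m.*2)%N ->
  (1 + `|x|) ^+ k <= 2 ^+ k * (1 + x ^+ m.*2).
Proof.
move=> km; have n0 := normr_ge0 x.
have -> : x ^+ m.*2 = `|x| ^+ m.*2.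
  by rewrite -normrX ger0_norm // -mul2n exprM exprn_ge0 // sqr_ge0.
have [x1|x1] := leP `|x| 1.
  apply: (@le_trans _ _ (2 ^+ k * 1)); last by rewrite ler_wpM2l // lerDl exprn_ge0.
  by rewrite mulr1 lerXn2r ?nnegrE ?addr_ge0 //; lra.
apply: (@le_trans _ _ (2 ^+ k * `|x| ^+ m.*2)); last by rewrite ler_wpM2l // lerDr.
apply: (@le_trans _ _ ((2 * `|x|) ^+ k)).
  by rewrite lerXn2r ?nnegrE ?addr_ge0 ?mulr_ge0 //; lra.
by rewrite exprMn ler_wpM2l // ler_weXn2l // ltW.
Qed.

(** * Moment bounds for a q^-1-Hermite weight *)

Section Moments.
Local Open Scope classical_set_scope.
Local Open Scope ring_scope.
Variables (R : realType) (q : R) (w : R -> R).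
Hypothesis hq : 0 < q < 1.
Hypothesis hw : qinvHermite_weight q w.
Hypothesis hw1 : \int[@lebesgue_measure R]_x w x = 1.
Implicit Types (t x y z : R) (n k N m : nat).

Let q0 : 0 < q. Proof. by case/andP: hq. Qed.
Let q1 : q < 1. Proof. by case/andP: hq. Qed.
Let mw := weight_measurable hw.
Let w0 := weight_ge0 hw.
Local Notation h := (qinvHermite q).

Lemma wintegrable_poly (p : {poly R}) : wintegrable w (fun x => p.[x]).
Proof.
apply: (@eq_wintegrable _ w
  (fun x => \sum_(0 <= i < size p) p`_i * x ^+ i)) => [x|].
  by rewrite horner_coef big_mkord.
by apply: wintegrable_sum => i; apply: wintegrableZ; exact: (weight_moments hw).
Qed.

Lemma wintegrable_mono_qinvHermite m k : wintegrable w (fun x => x ^+ m * h k x).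
Proof.
have [p hp] := qinvHermite_poly q k.
apply: eq_wintegrable (wintegrable_poly ('X^m * p)) => x.
by rewrite hornerM hornerXn hp.
Qed.

Lemma wint_qinvHermite k : wint w (h k) = (k == 0)%:R.
Proof.
case: k => [|k].
  by rewrite -hw1 /wint; apply: eq_Rintegral => x _; rewrite /h /= mul1r.
apply: etrans (weight_orthogonal hw (m := 0) (n := k.+1) isT).
apply: eq_Rintegral => x _.
by rewrite [h 0 x]/(1 : R) mulr1.
Qed.

(** [d m 0] is the m-th moment. The recurrence of h trades one power of x for a step from k to k + 1
    or k - 1, so the moments are weighted counts of lattice paths. *)
Let d m k := wint w (fun x => x ^+ m * h k x).

Let d_rec m k :
  d m.+1 k.+1 = d m k.+2 + 4^-1 * (q ^- k.+1 - 1) * d m k.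
Proof.
have ih := wintegrable_mono_qinvHermite.
rewrite /d -wintZ // -wintD //; last exact: wintegrableZ.
by apply: eq_wint => x; rewrite qinvHermiteS exprS; ring.
Qed.

Let d_rec0 m : d m.+1 0 = d m 1.
Proof.
apply: eq_wint => x; rewrite exprSr -mulrA; congr (_ * _).
by rewrite /h /= mulr0 subr0.
Qed.

Section Root.
Variable p : R.
Hypothesis p8 : p ^+ 8 = q.
Hypothesis p01 : 0 < p < 1.

Let pV_ge1 : 1 <= p^-1.
Proof. by case/andP: p01 => p0 p1; rewrite invf_ge1 // ltW. Qed.

(* p^-1 ^+ ((m + k) (m + k + 2)) is the product of q^-j for j <= (m + k) / 2,
   the weight of the heaviest lattice path from height k to 0 in m steps. *)
Let d_bound m k : ((m < k)%N -> d m k = 0) /\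
  `|d m k| <= 2 ^+ m * p^-1 ^+ ((m + k) * (m + k + 2)).
Proof.
have pV0 : 0 <= p^-1 by exact: le_trans ler01 pV_ge1.
elim: m k => [|m IH] k.
  have d0 : d 0 k = (k == 0)%:R.
    by rewrite -wint_qinvHermite; apply: eq_wint => x; rewrite mul1r.
  split; first by case: k d0.
  rewrite d0 expr0 mul1r; case: k {d0} => [|k]; first by rewrite normr1.
  by rewrite normr0 exprn_ge0.
case: k => [|k].
  rewrite d_rec0; split=> //; have [_ h1] := IH 1%N.
  rewrite addn0; rewrite addn1 in h1; apply: le_trans h1 _.
  by rewrite ler_wpM2r ?exprn_ge0 // ler_weXn2l ?ler1n.
have [z2 b2] := IH k.+2; have [z0 b0] := IH k.
rewrite d_rec; split.
  by move=> mk; rewrite z2 ?z0 ?mulr0 ?addr0 //; lia.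
have e2 : (m + k.+2 = m.+1 + k.+1)%N by rewrite addSnnS.
rewrite e2 in b2; set W := p^-1 ^+ _ in b2 *.
have W0 : 0 <= W by rewrite exprn_ge0.
have qk : 0 <= q ^- k.+1 - 1 <= q ^- k.+1.
  by rewrite subr_ge0 lerBlDr lerDl ler01 andbT invf_ge1 ?exprn_gt0 ?exprn_ile1 // ltW.
have {}b0 : `|4^-1 * (q ^- k.+1 - 1) * d m k| <= 2 ^+ m * W.
  have [mk|km] := ltnP m k.
    by rewrite z0 // mulr0 normr0 mulr_ge0 // exprn_ge0.
  case/andP: qk => qk0 qk1.
  rewrite !normrM (ger0_norm qk0) (_ : `|4^-1| = 4^-1 :> R); last by rewrite ger0_norm.
  apply: (@le_trans _ _ (1 * q ^- k.+1 * (2 ^+ m * p^-1 ^+ ((m + k) * (m + k + 2))))).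
    apply: ler_pM => //; first by rewrite mulr_ge0.
    by apply: ler_pM => //; rewrite invf_le1 // ler1n.
  rewrite mul1r mulrCA ler_wpM2l ?exprn_ge0 //.
  (* The exponent grows by 4(m + k + 2), and q^-(k+1) costs 8(k + 1); the inequality between them is
     exactly k <= m, the other case being a vanishing [d m k]. *)
  rewrite -p8 -exprM -exprVn -exprD /W ler_weXn2l //.
  by nia.
apply: le_trans (ler_normD _ _) _.
have -> : 2 ^+ m.+1 * W = 2 ^+ m * W + 2 ^+ m * W by rewrite exprS; ring.
exact: lerD.
Qed.

Lemma wint_even_moment_le m :
  wint w (fun x => x ^+ m.*2) <= 2 ^+ m.*2 * p^-1 ^+ (m.*2 * (m.*2 + 2)).
Proof.
have -> : wint w (fun x => x ^+ m.*2) = d m.*2 0.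
  by apply: eq_wint => x; rewrite [h 0 x]/(1 : R) mulr1.
have [_] := d_bound m.*2 0; rewrite addn0; apply: le_trans; exact: ler_norm.
Qed.

Lemma wint_onenorm_le k :
  wintegrable w (fun x => (1 + `|x|) ^+ k) /\
  (wint w (fun x => (1 + `|x|) ^+ k) <= 4 * 4 ^+ k * p^-1 ^+ (k.+1 * k.+3)).
Proof.
have pV0 : 0 <= p^-1 by exact: le_trans ler01 pV_ge1.
(* The least m with k <= 2m; rounding up costs one, whence the k + 1 in the bound. *)
pose m := uphalf k.
have km : (k <= m.*2)%N by rewrite /m; lia.
have mk : (m.*2 <= k.+1)%N by rewrite /m; lia.
have Pi : wintegrable w (fun x => 2 ^+ k * (1 + x ^+ m.*2)).
  apply: eq_wintegrable (wintegrable_poly ((2 ^+ k) *: (1 + 'X^(m.*2)))) => x.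
  by rewrite !hornerE.
have mf : measurable_fun [set: R] (fun x : R => (1 + `|x|) ^+ k).
  by apply: measurable_funX; apply: measurable_funD.
have fi : wintegrable w (fun x => (1 + `|x|) ^+ k).
  apply: (wintegrable_le mw mf Pi) => x.
  by rewrite ger0_norm ?expr_onenorm_le // exprn_ge0 // addr_ge0.
split=> //; apply: le_trans (le_wint w0 fi Pi (fun x => expr_onenorm_le x km)) _.
have i1 : wintegrable w (fun=> 1).
  by apply: eq_wintegrable (wintegrable_poly 1) => x; rewrite hornerC.
have i2 : wintegrable w (fun x => x ^+ m.*2).
  by apply: eq_wintegrable (wintegrable_poly 'X^(m.*2)) => x; rewrite hornerXn.
rewrite wintZ ?wintD //; last exact: wintegrableD.
have -> : wint w (fun=> 1) = 1 by have := wint_qinvHermite 0.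
have W1 : 1 <= p^-1 ^+ (k.+1 * k.+3) by rewrite exprn_ege1.
have b : wint w (fun x => x ^+ m.*2) <= 2 ^+ k.+1 * p^-1 ^+ (k.+1 * k.+3).
  apply: le_trans (wint_even_moment_le m) _.
  apply: ler_pM; rewrite ?exprn_ge0 //; first by rewrite ler_weXn2l ?ler1n.
  by rewrite ler_weXn2l //; apply: leq_mul; lia.
have k1 : 1 <= 2 ^+ k :> R by rewrite exprn_ege1 ?ler1n.
apply: (@le_trans _ _ (2 ^+ k * (2 * 2 ^+ k.+1 * p^-1 ^+ (k.+1 * k.+3)))).
  rewrite ler_wpM2l ?exprn_ge0 //; rewrite exprS in b *.
  set W := p^-1 ^+ _ in W1 b *; set T := 2 ^+ k in k1 b *.
  have : 1 * 1 <= T * W by apply: ler_pM.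
  by move: b; set X := wint _ _ => b; lra.
have -> : 4 ^+ k = 2 ^+ k * 2 ^+ k :> R by rewrite -exprMn; congr (_ ^+ _); ring.
by rewrite exprS le_eqVlt; apply/orP; left; apply/eqP; ring.
Qed.

End Root.

(* With z = q^(1/24): the majorant has base q^(1/3), so its k-th coefficient is of
   order q^(k^2/6), and this beats the k-th moment, of order q^(-k^2/8). *)
Lemma wintegrable_qexp (z : R) (B : R) : 0 < z < 1 -> z ^+ 24 = q -> 0 <= B ->
  wintegrable w (fun x => qexp (z ^+ 8) (B * (1 + `|x|))).
Proof.
move=> z01 z24 B0.
have z0 : 0 < z by case/andP: z01.
have z1 : z < 1 by case/andP: z01.
have zX n : 0 < z ^+ n.+1 < 1 by rewrite exprn_gt0 //= exprn_ilt1 // ltW.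
have p8 : (z ^+ 3) ^+ 8 = q by rewrite -exprM.
pose r := z ^+ 8; pose K := (1 - r)^-1.
have r1 : 0 < 1 - r by have := zX 7%N; rewrite subr_gt0 => /andP[].
have K0 : 0 < K by rewrite invr_gt0.
pose f k x := qexp_coef r k * (B * (1 + `|x|)) ^+ k.
have fE k : f k =1 (fun x => qexp_coef r k * B ^+ k * (1 + `|x|) ^+ k).
  by move=> x; rewrite /f exprMn; ring.
have coef_ge0 k : 0 <= qexp_coef r k by rewrite ltW // qexp_coef_gt0 // zX.
have hk k := wint_onenorm_le p8 (zX 2%N) k.
have fi k : wintegrable w (f k).
  apply: eq_wintegrable (wintegrableZ (qexp_coef r k * B ^+ k) (hk k).1) => x.
  by rewrite fE.
pose C := 4 * B * K / z ^+ 16.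
have C0 : 0 <= C by rewrite divr_ge0 ?mulr_ge0 ?exprn_ge0 // ltW.
have qpoch_le1 y n : 0 < y < 1 -> qpoch y y n <= 1.
  move=> /andP[y0 y1]; elim: n => [|n IH]; first by rewrite qpoch0.
  have y01 : 0 < y < 1 by rewrite y0.
  rewrite qpochS -exprS mulr_ile1 // ?(ltW (qpochqq_gt0 y01 n)) //.
    by rewrite ltW // onemqX_gt0.
  by rewrite lerBlDr lerDl exprn_ge0 // ltW.
have qpoch_ger n : (1 - r) ^+ n <= qpoch r r n.
  elim: n => [|n IH]; first by rewrite qpoch0.
  rewrite qpochS exprSr -exprS; apply: ler_pM => //; rewrite ?exprn_ge0 ?(ltW r1) //.
  rewrite lerD2l lerN2 exprS ler_piMr //; first by rewrite exprn_ge0 // ltW.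
  by rewrite exprn_ile1 // ?exprn_ge0 ?exprn_ile1 // ltW.
(* The surplus of q^(k^2/6) over q^(-k^2/8) leaves z^(2 C(k,2)), so the integrals are bounded by the
   terms of a q-exponential in base z^2. The constant [C] collects everything geometric in k; [K]
   comes from (1 - r)^k <= (r; r)_k. *)
have fb k : wint w (f k) <= 4 * (z ^+ 9)^-1 * (qexp_coef (z ^+ 2) k * C ^+ k).
  rewrite (eq_wint w (fE k)) wintZ; last exact: (hk k).1.
  apply: (@le_trans _ _ (r ^+ 'C(k, 2) * K ^+ k * B ^+ k *
     (4 * 4 ^+ k * (z ^+ 3)^-1 ^+ (k.+1 * k.+3)))).
    apply: ler_pM; last exact: (hk k).2.
    - by rewrite mulr_ge0 ?exprn_ge0.
    - by apply: wint_ge0 => // x; rewrite exprn_ge0 // addr_ge0.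
    rewrite ler_wpM2r ?exprn_ge0 // /qexp_coef ler_wpM2l ?exprn_ge0 // ?exprn_ge0 ?(ltW z0) //.
    by rewrite /K exprVn lef_pV2 // ?posrE ?exprn_gt0 // qpochqq_gt0 // zX.
  have Ck : ('C(k, 2) * 2 + k = k * k)%N.
    by elim: (k) => // n IH; rewrite binS bin1 mulnDl; nia.
  apply: (@le_trans _ _ (4 * (z ^+ 9)^-1 * (z ^+ (2 * 'C(k, 2)) * C ^+ k))); last first.
    rewrite ler_wpM2l ?divr_ge0 ?exprn_ge0 ?(ltW z0) // ler_wpM2r ?exprn_ge0 //.
    rewrite /qexp_coef exprM ler_peMr ?exprn_ge0 ?(ltW z0) //.
    by rewrite invf_ge1 ?qpochqq_gt0 ?qpoch_le1 ?zX.
  pose T := 4 * (4 * B * K) ^+ k.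
  have T0 : 0 <= T by rewrite mulr_ge0 ?exprn_ge0 // !mulr_ge0 // ltW.
  have -> : r ^+ 'C(k, 2) * K ^+ k * B ^+ k * (4 * 4 ^+ k * (z ^+ 3)^-1 ^+ (k.+1 * k.+3))
     = T * (z ^+ (8 * 'C(k, 2)) / z ^+ (3 * (k.+1 * k.+3))).
    rewrite /T (_ : r ^+ 'C(k, 2) = z ^+ (8 * 'C(k, 2))); last by rewrite exprM.
    rewrite (_ : (z ^+ 3)^-1 ^+ (k.+1 * k.+3) = (z ^+ (3 * (k.+1 * k.+3)))^-1).
      by rewrite !exprMn; ring.
    by rewrite exprVn -exprM.
  have -> : 4 * (z ^+ 9)^-1 * (z ^+ (2 * 'C(k, 2)) * C ^+ k)
     = T * (z ^+ (2 * 'C(k, 2)) / z ^+ (9 + 16 * k)).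
    by rewrite /T /C exprMn exprVn -exprM (exprD z 9) [(_ * z ^+ (16 * k))^-1]invfM; ring.
  (* Once 2 C(k,2) is cancelled, [Ck] reduces the comparison of exponents of z to 3k^2 + 12k + 9 <=
     3k^2 + 13k + 9. *)
  rewrite ler_wpM2l // ler_pdivrMr ?exprn_gt0 // mulrAC ler_pdivlMr ?exprn_gt0 //.
  rewrite -!exprD ler_wiXn2l ?(ltW z0) ?(ltW z1) //.
  by nia.
apply: (@wintegrable_series _ _ mw w0 f _ (4 * (z ^+ 9)^-1 * qexp (z ^+ 2) C)) => //.
- move=> k; apply: measurable_funM => //; apply: measurable_funX.
  by apply: measurable_funM => //; apply: measurable_funD.
- by move=> k x; rewrite mulr_ge0 // exprn_ge0 // mulr_ge0 // addr_ge0.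
- by move=> x; apply: qexp_cvg; exact: zX.
move=> n; apply: (@le_trans _ _ (4 * (z ^+ 9)^-1 * \sum_(0 <= k < n) (qexp_coef (z ^+ 2) k * C ^+ k))).
  by rewrite mulr_sumr; apply: ler_sum => k _; exact: fb.
rewrite ler_wpM2l ?divr_ge0 ?exprn_ge0 ?(ltW z0) //.
have := @sum_qconv_le_qexp _ _ (zX 1%N) n C 0 C0 (lexx 0).
rewrite qexp0 ?zX // mulr1; apply: le_trans.
by apply: ler_sum => k _; rewrite qconv_r0.
Qed.

End Moments.

(** * Integrals of products of generating functions *)

Section GeneratingIntegrals.
Local Open Scope classical_set_scope.
Local Open Scope ring_scope.
Variables (R : realType) (q : R) (w : R -> R).
Hypothesis hq : 0 < q < 1.
Hypothesis hw : qinvHermite_weight q w.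
Hypothesis hw1 : \int[@lebesgue_measure R]_x w x = 1.
Implicit Types (t x y z : R) (n k N m : nat).

Let q0 : 0 < q. Proof. by case/andP: hq. Qed.
Let q1 : q < 1. Proof. by case/andP: hq. Qed.
Let qN0 : q != 0. Proof. by rewrite gt_eqF. Qed.
Let mw := weight_measurable hw.
Let w0 := weight_ge0 hw.
Local Notation E := (qexp q).
Local Notation s := (qconv q).
Local Notation g := (qherm q).
Local Notation G := (qgen q).
Local Notation P := (q^-1).

Lemma qmaj3_dominated t1 t2 t3 : exists2 D, wintegrable w D &
  forall x, qmaj q t1 x * qmaj q t2 x * qmaj q t3 x <= D x.
Proof.
(* A 24th root of q: z^8 = q^(1/3) is the base in [qmaj3_le], and z^3 = q^(1/8) the root in the
   moment bound. *)
have [z z01 z24] := exists_root 23 hq.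
have [z0 z1] := andP z01.
have r01 : 0 < z ^+ 8 < 1 by rewrite exprn_gt0 //= exprn_ilt1 // ltW.
have [B B0 hB] := qmaj3_le r01 t1 t2 t3.
rewrite -exprM (z24 : z ^+ (8 * 3) = q) in hB.
exists (fun x => qexp (z ^+ 8) (B * (1 + `|x|))) => //.
exact: (wintegrable_qexp hq hw hw1 z01 z24 B0).
Qed.

Lemma measurable_qherm k : measurable_fun [set: R] (g k).
Proof.
have [p hp] := qinvHermite_poly q k.
have -> : g k = fun x => qexp_coef q k * 2 ^+ k *
    (\sum_(i < size p) p`_i * x ^+ i).
  by apply/funext => x; rewrite qherm_qinvHermite // hp horner_coef.
apply: measurable_funM => //; apply: measurable_sum => i.
by apply: measurable_funM => //; apply: measurable_funX.
Qed.

Let normr_qgen2_le t1 t2 x : `|G t1 x * G t2 x| <= qmaj q t1 x * qmaj q t2 x.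
Proof. by rewrite normrM; apply: ler_pM => //; exact: normr_qgen_le. Qed.

Lemma wintegrable_qgen3 t1 t2 t3 : wintegrable w (fun x => G t3 x * (G t1 x * G t2 x)).
Proof.
have [D Di hD] := qmaj3_dominated t3 t1 t2.
have mG t : measurable_fun [set: R] (G t) by exact: measurable_qgen.
apply: (wintegrable_le mw _ Di) => [|x].
  by apply: measurable_funM => //; apply: measurable_funM.
apply: le_trans (hD x); rewrite normrM -[leRHS]mulrA.
by apply: ler_pM => //; exact: normr_qgen_le.
Qed.

Lemma wintegrable_qherm k t1 t2 : wintegrable w (fun x => g k x * (G t1 x * G t2 x)).
Proof.
have [D Di hD] := qmaj3_dominated 1 t1 t2.
have mG t : measurable_fun [set: R] (G t) by exact: measurable_qgen.
have mg := measurable_qherm k.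
apply: (wintegrable_le mw _ Di) => [|x].
  by apply: measurable_funM => //; apply: measurable_funM.
apply: le_trans (hD x); rewrite normrM -[leRHS]mulrA.
by apply: ler_pM => //; exact: normr_qherm_le.
Qed.

(** The coefficient of t3^k in the integral of G_t3 G_t1 G_t2 w, by [A_cvg]. *)
Let A k t1 t2 := wint w (fun x => g k x * (G t1 x * G t2 x)).

Let A_cvg t1 t2 t3 :
  series (fun k => t3 ^+ k * A k t1 t2) @ \oo -->
  wint w (fun x => G t3 x * (G t1 x * G t2 x)).
Proof.
have [D Di hD] := qmaj3_dominated t3 t1 t2.
have mG t : measurable_fun [set: R] (G t) by exact: measurable_qgen.
pose f k x := t3 ^+ k * (g k x * (G t1 x * G t2 x)).
have mf k : measurable_fun [set: R] (f k).
  apply: measurable_funM => //; apply: measurable_funM.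
    exact: measurable_qherm.
  exact: measurable_funM.
have fD n x : \sum_(0 <= k < n) `|f k x| <= D x.
  apply: le_trans (hD x); rewrite -[leRHS]mulrA.
  under eq_bigr do rewrite /f mulrA normrM.
  rewrite -mulr_suml; apply: ler_pM => //; first exact: sumr_ge0.
  exact: sum_normr_qherm_le.
have fF x : series (f ^~ x) @ \oo --> G t3 x * (G t1 x * G t2 x).
  have -> : series (f ^~ x) =
     fun n => series (fun k => t3 ^+ k * g k x) n * (G t1 x * G t2 x).
    apply/funext => n; rewrite /series /= mulr_suml.
    by apply: eq_bigr => k _; rewrite /f mulrA.
  by apply: cvgMr_tmp; exact: qgen_cvg.
have [_] := wint_series_cvg mw w0 mf Di fD fF.
have -> : (fun k => wint w (f k)) =
   (fun k => t3 ^+ k * A k t1 t2) => //.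
by apply/funext => k; rewrite wintZ //; exact: wintegrable_qherm.
Qed.

Let Aprev k t1 t2 := if k is k'.+1 then A k' t1 t2 else 0.

(* From 2 x G_t = (q/t) (G_(t/q) - G_t) + (t/q) G_t. *)
Let A_rec k t1 t2 : t1 != 0 ->
  (P ^+ k - q) * A k.+1 t1 t2 =
  q / t1 * A k (P * t1) t2 + (P * t1 - q / t1) * A k t1 t2 - P * Aprev k t1 t2.
Proof.
move=> t1N0.
have gi := wintegrable_qherm.
have pi : wintegrable w (fun x => qherm_prev q k x * (G t1 x * G t2 x)).
  case: (k) => [|k']; last exact: gi.
  by apply: eq_wintegrable (wintegrableZ 0 (gi 0%N t1 t2)) => x; rewrite !mul0r.
have -> : Aprev k t1 t2 = wint w (fun x => qherm_prev q k x * (G t1 x * G t2 x)).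
  rewrite /Aprev; case: (k) => [|k'] //.
  rewrite -(mul0r (A 0 t1 t2)) -wintZ //.
  by apply: eq_wint => x; rewrite !mul0r.
rewrite /A -[- (P * _)]mulNr -!wintZ //.
have zi := wintegrableZ.
rewrite -wintD; [|exact: zi|exact: zi].
rewrite -wintD; [|by apply: wintegrableD; exact: zi|exact: zi].
apply: eq_wint => x; rewrite mulrA qherm_rec //.
rewrite (qgen_qshift hq (P * t1)) (mulVKf qN0) /qgen_factor.
by field; rewrite qN0.
Qed.

(** The closed form satisfies [A_rec], by [qconv_rec], [qconv_shiftl_prev] and the functional
    equation of E. The parameter t stays free in the induction because [A_rec] refers to t/q. *)
Let A_val t2 : (forall t, t != 0 -> A 0 t t2 = E (P * t * t2)) ->
  forall k t, t != 0 -> A k t t2 = E (P * t * t2) * P ^+ k * s k t t2.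
Proof.
move=> A0 k.
suff : (forall t, t != 0 -> A k t t2 = E (P * t * t2) * P ^+ k * s k t t2) /\
  (forall t, t != 0 ->
     Aprev k t t2 = E (P * t * t2) * (q * P ^+ k) * qconv_prev q k t t2) by case.
elim: k => [|k [IH1 IH2]].
  split=> t tN0; first by rewrite A0 // qconv0 !mulr1.
  by rewrite mulr0.
split=> t tN0; last first.
  by rewrite /= IH1 // exprS [q * _]mulrA mulfV // mul1r.
have P0 : 0 < P ^+ k - q.
  by rewrite subr_gt0 (lt_le_trans q1) // exprn_ege1 // invf_ge1 // ltW.
apply: (mulfI (lt0r_neq0 P0)); rewrite A_rec // IH2 // !IH1 ?mulf_neq0 ?invr_neq0 //.
rewrite qconv_shiftl_prev // (qexp_qshift hq (P * (P * t) * t2)).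
have -> : q * (P * (P * t) * t2) = P * t * t2 by field.
have := qconv_rec hq k t t2.
have -> : (P ^+ k - q) * (E (P * t * t2) * P ^+ k.+1 * s k.+1 t t2) =
  E (P * t * t2) * P ^+ k.+1 * ((P ^+ k - q) * s k.+1 t t2) by ring.
move=> ->; rewrite exprS; set U := P ^+ k.
by field; rewrite qN0.
Qed.

Let A_00 k : A k 0 0 = (k == 0)%:R.
Proof.
have [hi] := qinvHermite_poly q k => hp.
have -> : A k 0 0 = wint w (fun x => qexp_coef q k * 2 ^+ k * qinvHermite q k x).
  by apply: eq_wint => x; rewrite !qgen0 // !mulr1 qherm_qinvHermite.
rewrite wintZ; last by apply: eq_wintegrable (wintegrable_poly hw hi) => x.
rewrite wint_qinvHermite //; case: k {hp} => [|k]; last by rewrite mulr0.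
by rewrite qexp_coef0 !mulr1.
Qed.

Let A_0t t : A 0 t 0 = 1.
Proof.
have -> : A 0 t 0 = wint w (fun x => G t x * (G 0 x * G 0 x)).
  by apply: eq_wint => x; rewrite qherm0 !qgen0 // !mulr1 mul1r.
suff c : series (fun k => t ^+ k * A k 0 0) @ \oo --> (1 : R).
  by apply: (cvg_unique _ _ c) => //; exact: A_cvg.
(* After the shift every partial sum contains the term k = 0, the only nonzero one. *)
rewrite -(cvg_shiftS (series _)).
have -> : [sequence series (fun k => t ^+ k * A k 0 0) n.+1]_n = fun=> 1.
  apply/funext => n; rewrite /series /= big_nat_recl // A_00 mulr1 big1 ?addr0 //.
  by move=> i _; rewrite A_00 mulr0.
exact: cvg_cst.
Qed.

(** G_t2 is expanded, and [A_val] with second parameter 0, started by [A_0t], gives the terms of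
    Euler's series at t1 t2/q. *)
Let A_0tt t1 t2 : t1 != 0 -> A 0 t1 t2 = E (P * t1 * t2).
Proof.
move=> t1N0.
have -> : A 0 t1 t2 = wint w (fun x => G t2 x * (G t1 x * G 0 x)).
  by apply: eq_wint => x; rewrite qherm0 qgen0 // !mulr1 mul1r mulrC.
suff c : series (fun k => t2 ^+ k * A k t1 0) @ \oo --> E (P * t1 * t2).
  by apply: (cvg_unique _ _ c) => //; exact: A_cvg.
have -> : (fun k => t2 ^+ k * A k t1 0) =
    (fun k => qexp_coef q k * (P * t1 * t2) ^+ k).
  apply/funext => k; rewrite (@A_val 0) // => [|t _]; last by rewrite A_0t mulr0 qexp0.
  by rewrite mulr0 qexp0 // mul1r qconv_r0 !exprMn; ring.
exact: qexp_cvg.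
Qed.

(** In the expansion of G_t3, homogeneity absorbs (t3/q)^k into the convolution, whose sum over k
    factors by [qconv_cvg]. *)
Lemma wint_qgen3 t1 t2 t3 : t1 != 0 ->
  wint w (fun x => G t3 x * (G t1 x * G t2 x)) =
  E (P * t1 * t2) * E (P * t1 * t3) * E (P * t2 * t3).
Proof.
move=> t1N0.
suff c : series (fun k => t3 ^+ k * A k t1 t2) @ \oo -->
    E (P * t1 * t2) * E (P * t1 * t3) * E (P * t2 * t3).
  by apply: (cvg_unique _ _ c) => //; exact: A_cvg.
have -> : (fun k => t3 ^+ k * A k t1 t2) =
   (fun k => E (P * t1 * t2) * s k (P * t1 * t3) (P * t2 * t3)).
  apply/funext => k; rewrite (A_val (fun t => @A_0tt t t2) k t1N0).
  have -> : P * t1 * t3 = (P * t3) * t1 by ring.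
  have -> : P * t2 * t3 = (P * t3) * t2 by ring.
  by rewrite qconv_homog exprMn; ring.
have -> : series (fun k => E (P * t1 * t2) * s k (P * t1 * t3) (P * t2 * t3)) =
   fun n => E (P * t1 * t2) * series (fun k => s k (P * t1 * t3) (P * t2 * t3)) n.
  by apply/funext => n; rewrite /series /= mulr_sumr.
by rewrite -[E _ * _ * _]mulrA; apply: cvgMl_tmp; exact: qconv_cvg.
Qed.

End GeneratingIntegrals.

(** * The q-Chu-Vandermonde sum in base 1/q *)

Section QVandermonde.
Variables (R : realType) (q : R).
Hypothesis hq : 0 < q < 1.
Implicit Types (al ze be x : R) (n k : nat).
Let q0 : 0 < q. Proof. by case/andP: hq. Qed.
Let q1 : q < 1. Proof. by case/andP: hq. Qed.
Let qN0 : q != 0. Proof. by rewrite gt_eqF. Qed.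
Local Notation P := (q^-1).

(** The factors 1 + be q^-j with j < n are those that precede 1 + q be in the infinite product. *)
Lemma qexp_invshift be n : qexp q (q * be * P ^+ n) = qpoch (- be) P n * qexp q (q * be).
Proof.
elim: n => [|n IH]; first by rewrite qpoch0 mulr1 mul1r.
rewrite qexp_qshift // qpochS mulNr opprK.
have -> : q * be * P ^+ n.+1 = be * P ^+ n by rewrite exprS; field.
by rewrite [q * (be * _)]mulrA IH; ring.
Qed.

Lemma qpoch_quotnn al p n : qpoch_quot al p n n = 1 :> R.
Proof. by rewrite /qpoch_quot big_geq. Qed.

Lemma qpoch_quotK al p n k : (k <= n)%N ->
  qpoch_quot al p n k * qpoch al p k = qpoch al p n :> R.
Proof.
by move=> kn; rewrite /qpoch_quot /qpoch [RHS](@big_cat_nat _ _ _ k) //= mulrC.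
Qed.

Lemma qpoch_quot_recl al p n k : (k <= n)%N ->
  qpoch_quot al p n.+1 k = (1 - al * p ^+ k) * qpoch_quot (al * p) p n k :> R.
Proof.
move=> kn; rewrite /qpoch_quot big_nat_recl //; congr (_ * _).
by apply: eq_bigr => j _; rewrite exprS mulrA.
Qed.

Lemma qpoch_quotSS al p n k :
  qpoch_quot al p n.+1 k.+1 = qpoch_quot (al * p) p n k :> R.
Proof.
rewrite /qpoch_quot big_add1 /=.
by apply: eq_bigr => j _; rewrite exprS mulrA.
Qed.

Lemma onemPX_neq0 n : 1 - P ^+ n.+1 != 0.
Proof.
rewrite subr_eq0 lt_eqF // exprn_egt1 // invf_gt1 //.
Qed.

Lemma qpochPP_neq0 n : qpoch P P n != 0.
Proof.
elim: n => [|n IH]; first by rewrite qpoch0 oner_neq0.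
by rewrite qpochS -exprS mulf_neq0 // onemPX_neq0.
Qed.

Definition qVdM_coef n k : R := qpoch (q ^+ n) P k * (q ^- k / qpoch P P k).
Local Notation c := qVdM_coef.

Lemma qVdM_coefn0 n : c n 0 = 1.
Proof. by rewrite /c !qpoch0 expr0 !invr1 !mulr1. Qed.

Lemma qVdM_coef_gt n : c n n.+1 = 0.
Proof.
by rewrite /c qpochS exprVn mulfV ?expf_neq0 // subrr mulr0 mul0r.
Qed.

(** A Pascal rule, which drives the induction in [qVdM]. *)
Lemma qVdM_coefSS n k : c n.+1 k.+1 = q ^+ k.+1 * c n k.+1 - q ^+ k * c n k.
Proof.
rewrite /c qpochSl exprS [q * _ * P]mulrAC mulfV // mul1r.
rewrite !(qpochS _ _ k) -exprS.
have h := onemPX_neq0 k; have h' := qpochPP_neq0 k.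
have hk : q ^+ k != 0 by rewrite expf_neq0.
rewrite !exprS exprVn in h *.
have hd : q * q ^+ k - 1 != 0.
  have -> : q * q ^+ k - 1 = q * q ^+ k * (1 - q^-1 * (q ^+ k)^-1) by field; rewrite hk qN0.
  by rewrite !mulf_neq0.
by field; rewrite hk qN0 h' hd.
Qed.

(* The q-Chu-Vandermonde sum, with the denominator (al; 1/q)_n cleared. *)
Lemma qVdM n al ze :
  \sum_(0 <= k < n.+1) c n k * qpoch_quot al P n k * qpoch ze P k
  = \prod_(0 <= i < n) (ze - al * P ^+ i).
Proof.
elim: n al => [|n IH] al.
  by rewrite big_nat1 big_geq // qVdM_coefn0 qpoch_quotnn qpoch0 !mulr1.
rewrite [RHS]big_nat_recl // expr0 mulr1.
under [X in _ * X]eq_bigr do rewrite exprS mulrA.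
rewrite -IH mulr_sumr.
(* The Pascal rule splits the sum. With both halves indexed alike, their difference is, term by
   term, ze - al times the sum for n with al replaced by al/q. *)
have -> : \sum_(0 <= k < n.+2) c n.+1 k * qpoch_quot al P n.+1 k * qpoch ze P k =
  \sum_(0 <= k < n.+2) q ^+ k * c n k * qpoch_quot al P n.+1 k * qpoch ze P k
  - \sum_(0 <= k < n.+1) q ^+ k * c n k * qpoch_quot al P n.+1 k.+1 * qpoch ze P k.+1.
  rewrite big_nat_recl // [X in _ = X - _]big_nat_recl // !qVdM_coefn0 expr0 mul1r.
  rewrite !mul1r -addrA -sumrB; congr (_ + _); apply: eq_bigr => k _.
  by rewrite qVdM_coefSS; ring.
rewrite big_nat_recr //= qVdM_coef_gt mulr0 !mul0r addr0 -sumrB.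
apply: eq_big_nat => k /andP[_ kn].
rewrite qpoch_quotSS qpoch_quot_recl // qpochS.
have : q ^+ k * P ^+ k = 1 by rewrite exprVn mulfV // expf_neq0.
set Qk := q ^+ k; set Pk := P ^+ k => QP.
transitivity (Qk * Pk * (c n k * qpoch_quot (al * P) P n k * qpoch ze P k * (ze - al))).
  by ring.
by rewrite QP; ring.
Qed.

Lemma prod_PXqX n : \prod_(0 <= i < n) (P ^+ n * q ^+ i) = q ^- (n * n.+1)./2.
Proof.
rewrite -exprVn mulnC -(bin2 n.+1); elim: n => [|n IH]; first by rewrite big_geq.
rewrite big_nat_recl // expr0 mulr1 binS bin1 addnC exprD -IH; congr (_ * _).
by apply: eq_bigr => i _; rewrite !exprS; field.
Qed.

End QVandermonde.

(** * Polynomial form of the continuous dual q^-1-Hahn polynomials *)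

Section Basis.
Variables (R : realType) (q : R).
Hypothesis hq : 0 < q < 1.
Implicit Types (a b x : R) (n k : nat).
Let q0 : 0 < q. Proof. by case/andP: hq. Qed.
Let qN0 : q != 0. Proof. by rewrite gt_eqF. Qed.
Local Notation P := (q^-1).

(** (-e^u/a, e^(-u)/a; 1/q)_k as a polynomial in x; the j-th factor is [qgen_factor] at q^-j/a. *)
Definition cdq_basis a k : {poly R} :=
  \prod_(0 <= j < k) ((1 - (P ^+ j / a) ^+ 2)%:P + (2 * (P ^+ j / a)) *: 'X).

Lemma horner_cdq_basis a k x :
  (cdq_basis a k).[x] = \prod_(0 <= j < k) qgen_factor (P ^+ j / a) x.
Proof.
rewrite /cdq_basis horner_prod; apply: eq_bigr => j _.
by rewrite hornerD hornerC hornerZ hornerX /qgen_factor; ring.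
Qed.

Lemma cdq_basis_qpoch a k x :
  qpoch (- (expR (arsinh x) / a)) P k * qpoch (expR (- arsinh x) / a) P k
  = (cdq_basis a k).[x].
Proof.
rewrite horner_cdq_basis /qpoch -big_split /=; apply: eq_bigr => j _.
by rewrite qgen_factorE; ring.
Qed.

(** Each factor of the basis element divides the parameter of the generating function by q once, by
    [qgen_qshift]. *)
Lemma cdq_basis_qgen a k x :
  (cdq_basis a k).[x] * qgen q (q / a) x = qgen q (q / a * P ^+ k) x.
Proof.
rewrite horner_cdq_basis; elim: k => [|k IH]; first by rewrite big_geq // mul1r mulr1.
rewrite big_nat_recr //= mulrAC IH [RHS]qgen_qshift // mulrC exprS.
have -> : q / a * (P * P ^+ k) = P ^+ k / a by rewrite mulrACA mulfV // mul1r mulrC.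
by rewrite [q * (_ / _)]mulrA [in RHS]mulrAC.
Qed.

Lemma cdq_basis_lead a k : a != 0 ->
  size (cdq_basis a k) = k.+1 /\
  (cdq_basis a k)`_k = \prod_(0 <= j < k) (2 * (P ^+ j / a)).
Proof.
move=> a0.
suff [h1 h2] : size (cdq_basis a k) = k.+1 /\
  lead_coef (cdq_basis a k) = \prod_(0 <= j < k) (2 * (P ^+ j / a)).
  by rewrite h1 -h2 lead_coefE h1.
have cN0 j : 2 * (P ^+ j / a) != 0.
  by rewrite !mulf_neq0 ?invr_neq0 ?expf_neq0 ?invr_neq0 // pnatr_eq0.
have sz j : size ((1 - (P ^+ j / a) ^+ 2)%:P + (2 * (P ^+ j / a)) *: 'X) = 2%N.
  rewrite addrC size_polyDl ?size_scale ?size_polyX //.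
  by rewrite size_polyC; case: (_ != 0).
have lc j : lead_coef ((1 - (P ^+ j / a) ^+ 2)%:P + (2 * (P ^+ j / a)) *: 'X)
   = 2 * (P ^+ j / a).
  by rewrite lead_coefE sz /= coefD coefC coefZ coefX /= add0r mulr1.
rewrite /cdq_basis; elim: k => [|k [IH1 IH2]].
  by rewrite !big_geq // size_poly1 lead_coef1.
rewrite !big_nat_recr //= lead_coefM lc IH2; split=> //.
rewrite size_mul ?sz ?IH1 ?addn2 //; first by rewrite -size_poly_eq0 IH1.
by rewrite -size_poly_eq0 sz.
Qed.

Definition cdqHahn_poly a b c n : {poly R} :=
  (- (a / 2)) ^+ n *: \sum_(0 <= k < n.+1)
    (qVdM_coef q n k * qpoch_quot (- (a * b)^-1) P n k
       * qpoch_quot (- (a * c)^-1) P n k) *: cdq_basis a k.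

Lemma cdqHahnE a b c n x : cdqHahn q a b c n x = (cdqHahn_poly a b c n).[x].
Proof.
rewrite /cdqHahn /cdqHahn_poly hornerZ horner_sum; congr (_ * _).
apply: eq_bigr => k _; rewrite hornerZ -cdq_basis_qpoch /qVdM_coef.
by rewrite /qpochs !big_cons big_nil; ring.
Qed.

Lemma cdqHahn_poly_size a b c n : a != 0 -> (size (cdqHahn_poly a b c n) <= n.+1)%N.
Proof.
move=> a0; apply: leq_trans (size_scale_leq _ _) _.
rewrite big_mkord; apply: leq_trans (size_sum _ _ _) _; apply/bigmax_leqP => k _.
apply: leq_trans (size_scale_leq _ _) _.
by have [-> _] := cdq_basis_lead k a0.
Qed.

(** Only k = n reaches degree n. Passing from n to n + 1 multiplies its coefficient by
    (-a/2)(-q^n)(2 q^-n/a) = 1. *)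
Lemma cdqHahn_poly_monic a b c n : a != 0 -> (cdqHahn_poly a b c n)`_n = 1.
Proof.
move=> a0; rewrite /cdqHahn_poly coefZ coef_sum big_nat_recr //= big1_seq ?add0r.
  rewrite coefZ !qpoch_quotnn !mulr1 (cdq_basis_lead n a0).2.
  elim: n => [|n IH]; first by rewrite qVdM_coefn0 big_geq // !mulr1.
  rewrite big_nat_recr //= qVdM_coefSS // qVdM_coef_gt // mulr0 sub0r -[RHS]IH exprS.
  have : q ^+ n * P ^+ n = 1 by rewrite exprVn mulfV // expf_neq0.
  set Q := q ^+ n; set Pn := P ^+ n; set U := \prod_(_ <= _ < _) _ => QP.
  transitivity (Q * Pn * ((- (a / 2)) ^+ n * (qVdM_coef q n n * U))); last by rewrite QP mul1r.
  by field.
move=> k; rewrite mem_index_iota => /andP[_ kn].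
rewrite coefZ nth_default ?mulr0 //.
by have [-> _] := cdq_basis_lead k a0.
Qed.

End Basis.

(** * Orthogonality and the value of the norm *)

Section Orthogonality.
Variables (R : realType) (q a b c : R) (w : R -> R).
Hypothesis hq : 0 < q < 1.
Hypothesis hw : qinvHermite_weight q w.
Hypothesis hw1 : \int[@lebesgue_measure R]_x w x = 1.
Hypotheses (aN0 : a != 0) (bN0 : b != 0) (cN0 : c != 0).
Implicit Types (x t : R) (n k m j : nat) (p : {poly R}).
Let q0 : 0 < q. Proof. by case/andP: hq. Qed.
Let qN0 : q != 0. Proof. by rewrite gt_eqF. Qed.
Local Notation P := (q^-1).
Local Notation E := (qexp q).
Local Notation G := (qgen q).

Let Gabc x := G (q / c) x * (G (q / a) x * G (q / b) x).

Lemma cdqHahn_weightE x : cdqHahn_weight q a b c w x = Gabc x * w x.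
Proof.
rewrite /cdqHahn_weight /Gabc /qgen /qpochs_inf !big_cons big_nil /qexp !opprK.
by ring.
Qed.

Lemma cdqHahn_normE n : cdqHahn_norm q a b c n =
  4 ^- n * q ^- (n * n.+1)./2 *
  (E (q * (a * b)^-1 * P ^+ n) * E (q * (a * c)^-1 * P ^+ n)
     * E (q * (b * c)^-1 * P ^+ n)) * qpoch (q ^+ n) P n.
Proof.
have e x y : q * (x * y)^-1 * P ^+ n = q / (x * y * q ^+ n).
  by rewrite exprVn [in RHS]invfM mulrA.
rewrite /cdqHahn_norm /qpochs_inf !big_cons big_nil mulr1 /qexp -!e.
by ring.
Qed.

(** x G_t is a linear combination of G_(t/q) and G_t, so powers of x are removed at the price of
    moving t, which is therefore free in the induction. *)
Let wintegrable_mono_qgen n t : t != 0 ->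
  wintegrable w (fun x => x ^+ n * (G (q / c) x * (G t x * G (q / b) x))).
Proof.
elim: n t => [|n IH] t tN0.
  apply: eq_wintegrable (wintegrable_qgen3 hq hw hw1 t (q / b) (q / c)) => x.
  by rewrite mul1r.
have PtN0 : P * t != 0 by rewrite mulf_neq0 ?invr_neq0.
apply: eq_wintegrable (wintegrableD (wintegrableZ (q / (2 * t)) (IH _ PtN0))
  (wintegrableZ (P * t / 2 - q / (2 * t)) (IH _ tN0))) => x.
rewrite (qgen_qshift hq (P * t)) (mulVKf qN0) /qgen_factor (exprS x n).
by field; rewrite qN0 tN0.
Qed.

(** The moment functional of w(x; a, b, c). *)
Let Psi p := wint w (fun x => p.[x] * Gabc x).

Lemma wintegrable_poly_Gabc p : wintegrable w (fun x => p.[x] * Gabc x).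
Proof.
apply: (@eq_wintegrable _ w
  (fun x => \sum_(0 <= i < size p) p`_i * (x ^+ i * Gabc x))) => [x|].
  rewrite horner_coef big_mkord mulr_suml.
  by apply: eq_bigr => i _; rewrite mulrA.
apply: wintegrable_sum => i; apply: wintegrableZ.
by apply: wintegrable_mono_qgen; rewrite mulf_neq0 ?invr_neq0.
Qed.

Let PsiD p p' : Psi (p + p') = Psi p + Psi p'.
Proof.
rewrite /Psi -wintD; [|exact: wintegrable_poly_Gabc..].
by apply: eq_wint => x; rewrite hornerD mulrDl.
Qed.

Let PsiZ (d : R) p : Psi (d *: p) = d * Psi p.
Proof.
rewrite /Psi -wintZ; last exact: wintegrable_poly_Gabc.
by apply: eq_wint => x; rewrite hornerZ -mulrA.
Qed.

Let Psi0 : Psi 0 = 0.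
Proof. by have := PsiZ 0 0; rewrite scale0r mul0r. Qed.

Let Psi_sum n (F : nat -> {poly R}) :
  Psi (\sum_(0 <= k < n) F k) = \sum_(0 <= k < n) Psi (F k).
Proof.
elim: n => [|n IH]; last by rewrite !big_nat_recr //= PsiD IH.
by rewrite !big_geq // Psi0.
Qed.

(** The two basis elements only move the parameters q/a and q/b, to q^(1-k)/a and q^(1-j)/b, so
    [wint_qgen3] applies. *)
Let Psi_basis k j : Psi (cdq_basis q a k * cdq_basis q b j) =
  E (q * (a * b)^-1 * P ^+ (j + k)) * E (q * (a * c)^-1 * P ^+ k)
  * E (q * (b * c)^-1 * P ^+ j).
Proof.
have tN0 : q / a * P ^+ k != 0.
  by rewrite !mulf_neq0 ?expf_neq0 ?invr_neq0.
transitivity (wint w (fun x => G (q / c) x *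
   (G (q / a * P ^+ k) x * G (q / b * P ^+ j) x))).
  apply: eq_wint => x; rewrite hornerM /Gabc -!cdq_basis_qgen //.
  by ring.
rewrite wint_qgen3 //; congr (E _ * E _ * E _).
- by rewrite exprD invfM; field; rewrite bN0 aN0.
- by rewrite invfM; field; rewrite cN0 aN0.
- by rewrite invfM; field; rewrite cN0 bN0.
Qed.

Local Notation Q := (cdqHahn_poly q a b c).

(** The quotient in ac completes its q-exponential to one independent of k; what remains is [qVdM]
    with al = -1/(ab) and ze = -q^-j/(ab). *)
Let Psi_cdqHahn_basis n j : Psi (Q n * cdq_basis q b j) =
  (- (a / 2)) ^+ n * (E (q * (a * b)^-1 * P ^+ j) * E (q * (a * c)^-1 * P ^+ n)
     * E (q * (b * c)^-1 * P ^+ j)) *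
  \prod_(0 <= i < n) (- (a * b)^-1 * P ^+ j - - (a * b)^-1 * P ^+ i).
Proof.
rewrite /cdqHahn_poly -scalerAl PsiZ -mulrA; congr (_ * _).
rewrite mulr_suml Psi_sum -(qVdM hq) mulr_sumr; apply: eq_big_nat => k /andP[_ kn].
rewrite -scalerAl PsiZ Psi_basis.
have -> : q * (a * b)^-1 * P ^+ (j + k) = q * ((a * b)^-1 * P ^+ j) * P ^+ k.
  by rewrite exprD; ring.
rewrite (qexp_invshift hq ((a * b)^-1 * P ^+ j) k) (mulrA q) -(mulNr _ (P ^+ j)).
rewrite (qexp_invshift hq (a * c)^-1 k).
rewrite (qexp_invshift hq (a * c)^-1 n).
rewrite -(@qpoch_quotK _ (- (a * c)^-1) P n k kn).
by ring.
Qed.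

(** At j = n the product splits into the leading coefficient of [cdq_basis q b n] and the elementary
    factors of k_n. *)
Let cdqHahn_norm_prod n :
  (- (a / 2)) ^+ n *
  \prod_(0 <= i < n) (- (a * b)^-1 * P ^+ n - - (a * b)^-1 * P ^+ i)
  = \prod_(0 <= j < n) (2 * (P ^+ j / b)) *
    (4 ^- n * q ^- (n * n.+1)./2 * qpoch (q ^+ n) P n).
Proof.
rewrite -prod_PXqX // /qpoch -(exprVn 4).
have cst (z : R) : z ^+ n = \prod_(0 <= i < n) z by rewrite prodr_const_nat subn0.
rewrite (cst (- (a / 2))) (cst 4^-1) -!big_split /=; apply: eq_bigr => i _.
have : q ^+ n * P ^+ n = 1 by rewrite exprVn mulfV // expf_neq0.
have : q ^+ i * P ^+ i = 1 by rewrite exprVn mulfV // expf_neq0.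
set Qi := q ^+ i; set Pi := P ^+ i; set Qn := q ^+ n; set Pn := P ^+ n => QPi QPn.
transitivity (2 * Pi / b * (4^-1 * (Pn * Qi - (Qn * Pn) * (Qi * Pi)))); last by ring.
rewrite QPi QPn mulr1.
transitivity (4^-1 * (2 * b^-1) * (Pn * (Qi * Pi) - Pi)); last by ring.
by rewrite QPi mulr1; field; rewrite aN0 bN0.
Qed.

Let Psi_cdqHahn_lt n p : (size p <= n)%N -> Psi (Q n * p) = 0.
Proof.
suff h m p' : (m <= n)%N -> (size p' <= m)%N -> Psi (Q n * p') = 0 by exact: h.
elim: m p' => [|m IH] {}p mn sp.
  move: sp; rewrite leqn0 size_poly_eq0 => /eqP ->.
  by rewrite mulr0 Psi0.
have [sB lB] := cdq_basis_lead hq m bN0.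
pose d := p`_m / (cdq_basis q b m)`_m.
have lB0 : (cdq_basis q b m)`_m != 0.
  have := lead_coefE (cdq_basis q b m); rewrite sB /= => <-.
  by rewrite lead_coef_eq0 -size_poly_eq0 sB.
have -> : p = (p - d *: cdq_basis q b m) + d *: cdq_basis q b m by rewrite subrK.
rewrite mulrDr PsiD (IH _ (ltnW mn)) ?add0r; last first.
  apply/leq_sizeP => i mi; rewrite coefB coefZ.
  move: mi; rewrite leq_eqVlt => /predU1P[<-|mi].
    by rewrite /d divfK // subrr.
  by rewrite !nth_default ?mulr0 ?subr0 ?sB // (leq_trans sp).
rewrite -scalerAr PsiZ Psi_cdqHahn_basis.
(* Since m < n, the product contains the zero factor i = m. *)
by rewrite (big_rem m) ?mem_index_iota //= subrr mul0r !mulr0.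
Qed.

(** Removing the multiple of [cdq_basis q b n] with the same coefficient of x^n leaves a degree
    below n, which [Psi_cdqHahn_lt] annihilates. *)
Let Psi_cdqHahn_eq n p : (size p <= n.+1)%N ->
  Psi (Q n * p) = p`_n * cdqHahn_norm q a b c n.
Proof.
move=> sp.
have [sB lB] := cdq_basis_lead hq n bN0.
pose d := p`_n / (cdq_basis q b n)`_n.
have lB0 : (cdq_basis q b n)`_n != 0.
  have := lead_coefE (cdq_basis q b n); rewrite sB /= => <-.
  by rewrite lead_coef_eq0 -size_poly_eq0 sB.
have -> : Psi (Q n * p) =
   Psi (Q n * (p - d *: cdq_basis q b n)) + d * Psi (Q n * cdq_basis q b n).
  by rewrite -PsiZ -PsiD scalerAr -mulrDr subrK.
rewrite Psi_cdqHahn_lt ?add0r; last first.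
  apply/leq_sizeP => i; rewrite coefB coefZ leq_eqVlt => /predU1P[<-|ni].
    by rewrite /d divfK // subrr.
  by rewrite !nth_default ?mulr0 ?subr0 ?sB // (leq_trans sp).
rewrite Psi_cdqHahn_basis [X in d * X]mulrAC cdqHahn_norm_prod cdqHahn_normE /d lB.
rewrite lB in lB0; set D := \prod_(0 <= j < n) _ in lB0 *.
by set U := 4 ^- n; set V := q ^- _; field.
Qed.

Lemma cdqHahn_wintegrable n m : wintegrable (cdqHahn_weight q a b c w)
  (fun x => cdqHahn q a b c n x * cdqHahn q a b c m x).
Proof.
rewrite /wintegrable.
have := wintegrable_poly_Gabc (Q n * Q m); apply: eq_integrable => // x _ /=.
by rewrite !cdqHahnE // hornerM cdqHahn_weightE mulrA.
Qed.

Lemma cdqHahn_wint n m : wint (cdqHahn_weight q a b c w)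
  (fun x => cdqHahn q a b c n x * cdqHahn q a b c m x)
  = cdqHahn_norm q a b c n * (m == n)%:R.
Proof.
have -> : wint (cdqHahn_weight q a b c w)
    (fun x => cdqHahn q a b c n x * cdqHahn q a b c m x) = Psi (Q n * Q m).
  apply: eq_Rintegral => x _.
  by rewrite !cdqHahnE // hornerM cdqHahn_weightE mulrA.
have sQ k : (size (Q k) <= k.+1)%N by exact: cdqHahn_poly_size.
have [mn|nm|->] := ltngtP m n; rewrite ?mulr0 ?mulr1.
- by rewrite Psi_cdqHahn_lt // (leq_trans (sQ m)).
- by rewrite mulrC Psi_cdqHahn_lt // (leq_trans (sQ n)).
- by rewrite Psi_cdqHahn_eq // cdqHahn_poly_monic // mul1r.
Qed.

End Orthogonality.

(** * Nonvanishing and sign of the norm *)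

Section NormSign.
Variables (R : realType) (q : R).
Hypothesis hq : 0 < q < 1.
Implicit Types (t : R) (n : nat).
Let q0 : 0 < q. Proof. by case/andP: hq. Qed.
Let q1 : q < 1. Proof. by case/andP: hq. Qed.
Let qN0 : q != 0. Proof. by rewrite gt_eqF. Qed.
Local Notation P := (q^-1).
Local Notation E := (qexp q).

Lemma qpochqX_gt0 n : 0 < qpoch (q ^+ n) P n.
Proof.
rewrite /qpoch big_nat_cond prodr_gt0 // => i /andP[/andP[_ iN] _].
by rewrite exprVn -expfB // subr_gt0 exprn_ilt1 ?(ltW q0) // subn_eq0 -ltnNge.
Qed.

(** A zero factor forces t = -q^(k+1-n): this lies in [-1, 0] if n <= k + 1, and is a negative power
    of q up to sign otherwise. *)
Lemma qexp_invX_neq0 t n : (forall k, (1 <= k)%N -> t != - q ^- k) ->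
  ~~ (-1 <= t <= 0) -> E (q * t^-1 * P ^+ n) != 0.
Proof.
move=> hk ht.
have t0 : t != 0 by apply: contraNneq ht => ->; rewrite lexx lerN10.
apply: qexp_neq0 => // k; apply/eqP => /eqP.
rewrite addr_eq0 => /eqP e1.
have te : t = - (q * P ^+ n * q ^+ k).
  transitivity (t * - (q * t^-1 * P ^+ n * q ^+ k)); first by rewrite -e1 mulr1.
  by field.
have [nk|kn] := leqP n k.+1.
  move: ht; rewrite te.
  have -> : q * P ^+ n * q ^+ k = q ^+ (k.+1 - n).
    by rewrite expfB_cond ?(negbTE qN0) // exprS exprVn mulrAC.
  by rewrite lerN2 oppr_le0 exprn_ge0 ?(ltW q0) // exprn_ile1 ?ltW.
have := hk (n - k.+1)%N; rewrite subn_gt0 => /(_ kn); rewrite te.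
have -> : q * P ^+ n * q ^+ k = q ^- (n - k.+1).
  rewrite expfB_cond ?(negbTE qN0) ?(ltnW kn) // exprS exprVn invfM invrK.
  by ring.
by rewrite eqxx.
Qed.

(** For t > 0 every factor exceeds 1. For t < -q^(1-n) the smallest factor is the first, 1 +
    q^(1-n)/t, which is positive. *)
Lemma qexp_invX_gt0 t n : ~~ (- (q / q ^+ n) <= t <= 0) -> 0 < E (q * t^-1 * P ^+ n).
Proof.
move=> ht; apply: qexp_gt0 => // k.
have qk0 : 0 < q ^+ k by rewrite exprn_gt0.
have qk1 : q ^+ k <= 1 by rewrite exprn_ile1 // ltW.
have Qn0 : 0 < q * P ^+ n by rewrite mulr_gt0 // exprn_gt0 // invr_gt0.
have [t0|t0] := ltP 0 t.
  by rewrite ltr_wpDr // ltW // mulr_gt0 // mulrAC mulr_gt0 // invr_gt0.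
move: ht; rewrite t0 andbT -ltNge -exprVn => ht.
have tN : t < 0 by rewrite (lt_trans ht) // oppr_lt0.
rewrite -ltrBlDl sub0r.
have -> : q * t^-1 * P ^+ n * q ^+ k = - ((q * P ^+ n) / (- t) * q ^+ k).
  by rewrite invrN; ring.
rewrite ltrN2; apply: (@le_lt_trans _ _ (q * P ^+ n / - t)).
  by rewrite ler_piMr // ltW // divr_gt0 // oppr_gt0.
by rewrite ltr_pdivrMr ?oppr_gt0 // mul1r ltrNr.
Qed.

End NormSign.

(** The hypotheses do not fix the sign of k_n: for t = ab < -1 a factor 1 + q^(1-n+k)/t may be
    negative. Hence the norm is shown to be nonzero, to be positive when the three products avoid
    [-q^(1-n), 0], and to have its positivity decided by a finite product. *)
Theorem theorem6 (R : realType) (q a b c : R) (w : R -> R)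
    (hq : 0 < q < 1)
    (hpow : forall (t : R) (k : nat), t \in [:: a * b; a * c; b * c] ->
       (1 <= k)%N -> t != - q ^- k)
    (hitv : forall t : R, t \in [:: a * b; a * c; b * c] ->
       ~~ (-1 <= t <= 0))
    (hw : qinvHermite_weight q w)
    (hw1 : \int[lebesgue_measure]_x w x = 1) :
  (forall m n : nat,
     lebesgue_measure.-integrable [set: R]
       (fun x => (cdqHahn q a b c n x * cdqHahn q a b c m x
                  * cdqHahn_weight q a b c w x)%:E)
     /\ \int[lebesgue_measure]_x (cdqHahn q a b c n x * cdqHahn q a b c m x
                  * cdqHahn_weight q a b c w x)
        = cdqHahn_norm q a b c n * (m == n)%:R)
  /\ (forall n : nat, cdqHahn_norm q a b c n != 0)
  /\ (forall n : nat,
        (forall t : R, t \in [:: a * b; a * c; b * c] ->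
           ~~ (- (q / q ^+ n) <= t <= 0)) ->
        0 < cdqHahn_norm q a b c n)
  /\ (forall n : nat,
        0 < cdqHahn_norm q a b c n <->
        0 < qpochs [:: - (a * b)^-1; - (a * c)^-1; - (b * c)^-1] q^-1 n).
Proof.
have [q0 q1] := andP hq.
have tab : a * b \in [:: a * b; a * c; b * c] by rewrite !inE eqxx.
have tac : a * c \in [:: a * b; a * c; b * c] by rewrite !inE eqxx orbT.
have tbc : b * c \in [:: a * b; a * c; b * c] by rewrite !inE eqxx !orbT.
(* 0 belongs to the excluded interval, so a, b and c are nonzero. *)
have tN0 t : t \in [:: a * b; a * c; b * c] -> t != 0.
  by move/hitv; apply: contraNneq => ->; rewrite lexx lerN10.
have /norP[aN0 bN0] : ~~ ((a == 0) || (b == 0)) by rewrite -mulf_eq0 tN0.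
have /norP[_ cN0] : ~~ ((b == 0) || (c == 0)) by rewrite -mulf_eq0 tN0.
pose K n : R := 4 ^- n * q ^- (n * n.+1)./2 * qpoch (q ^+ n) q^-1 n.
have K0 n : 0 < K n.
  by rewrite !mulr_gt0 ?invr_gt0 ?exprn_gt0 ?qpochqX_gt0.
have normE n : cdqHahn_norm q a b c n = K n *
  (qexp q (q * (a * b)^-1 * q^-1 ^+ n) * qexp q (q * (a * c)^-1 * q^-1 ^+ n)
     * qexp q (q * (b * c)^-1 * q^-1 ^+ n)).
  by rewrite cdqHahn_normE // /K; ring.
split; [|split; [|split]].
- move=> m n; split; first exact: cdqHahn_wintegrable.
  exact: cdqHahn_wint.
- move=> n.
  have E0 t : t \in [:: a * b; a * c; b * c] -> qexp q (q * t^-1 * q^-1 ^+ n) != 0.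
    by move=> tin; apply: (qexp_invX_neq0 hq) => [k|]; [exact: hpow|exact: hitv].
  rewrite normE; apply: mulf_neq0; first by rewrite gt_eqF.
  by apply: mulf_neq0; [apply: mulf_neq0|]; exact: E0.
- move=> n ht.
  have E0 t : t \in [:: a * b; a * c; b * c] -> 0 < qexp q (q * t^-1 * q^-1 ^+ n).
    by move=> tin; apply: (qexp_invX_gt0 hq); exact: ht.
  rewrite normE; apply: mulr_gt0 => //.
  by apply: mulr_gt0; [apply: mulr_gt0|]; exact: E0.
move=> n; rewrite normE !qexp_invshift //.
(* The case n = 0 of [qexp_invX_gt0], whose interval [-q, 0] lies in [-1, 0]; the sign is thus
   carried by the finite products alone. *)
have E0 t : t \in [:: a * b; a * c; b * c] -> 0 < qexp q (q * t^-1).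
  move=> tin; rewrite -[q * _]mulr1 -(expr0 q^-1); apply: qexp_invX_gt0 => //.
  apply: contra (hitv t tin) => /andP[tq ->]; rewrite andbT.
  by apply: le_trans tq; rewrite expr0 divr1 lerN2 ltW.
rewrite /qpochs !big_cons big_nil mulr1.
set A := qpoch (- (a * b)^-1) _ n; set B := qpoch (- (a * c)^-1) _ n.
set C := qpoch (- (b * c)^-1) _ n.
have -> : K n * (A * qexp q (q * (a * b)^-1) * (B * qexp q (q * (a * c)^-1))
    * (C * qexp q (q * (b * c)^-1))) =
  K n * qexp q (q * (a * b)^-1) * qexp q (q * (a * c)^-1) * qexp q (q * (b * c)^-1)
    * (A * (B * C)) by ring.
by rewrite pmulr_rgt0 //; do 3?[apply: mulr_gt0; last exact: E0].
Qed.
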